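(* Let $\gamma\in\,]0,1[$ with $\gamma^{-1}\notin\mathbb N$, let $N=\lfloor\gamma^{-1}\rfloor$, and let $X$ be a branched $\gamma$-rough path. There exists an anisotropic geometric rough path $\bar X$ indexed by words on the alphabet $\mathcal T_N$, with exponents $(\gamma_\tau=\gamma|\tau|,\ \tau\in\mathcal T_N)$, such that $$\langle X_{st},\tau\rangle=\langle\bar X_{st},\psi(\tau)\rangle,\qquad s,t\in[0,1],$$ for all forests $\tau$ with at most $N$ nodes, where $\psi$ is the Hairer--Kelly map.
   Context: Fix $d\ge1$. $\mathcal T$ is the set of non-empty non-planar rooted trees with nodes decorated by $\{1,\dots,d\}$; $\mathcal F$ is the set of forests (finite multisets of elements of $\mathcal T$, including the empty forest $\mathbf 1$); $|\tau|$ is the number of nodes of $\tau$; $\mathcal T_n=\{\tau\in\mathcal T:|\tau|\le n\}$. $\mathcal H_{\mathrm{BCK}}$ is the real vector space spanned by $\mathcal F$, with product given by disjoint union of forests, and coproduct $\Delta$ the unique algebra morphism with $\Delta[\tau]_i=[\tau]_i\otimes\mathbf 1+(\mathrm{id}\otimes[\cdot]_i)\Delta\tau$, where $[\tau_1\cdots\tau_k]_i$ is the tree obtained by grafting $\tau_1,\dots,\tau_k$ onto a new root decorated by $i$. Put $\Delta'\tau=\Delta\tau-\tau\otimes\mathbf 1-\mathbf 1\otimes\tau$; for a tree $\tau$, $\Delta'\tau$ is a sum of terms (forest)$\otimes$(tree). $G$ is the set of characters (nonzero multiplicative linear functionals) of $\mathcal H_{\mathrm{BCK}}$, with product $\langle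 X\star Y,\tau\rangle=\langle X\otimes Y,\Delta\tau\rangle$. A branched $\gamma$-rough path is a map $X:[0,1]^2\to G$ with $X_{su}\star X_{ut}=X_{st}$ for all $s,u,t$ and, for each $\tau\in\mathcal F$, $|\langle X_{st},\tau\rangle|\le C_\tau|t-s|^{\gamma|\tau|}$ for all $s,t\in[0,1]$. For an alphabet $A$, $T(A)$ is the real vector space spanned by words in $A$ (concatenation of letters is denoted by $\otimes$ when letters are trees), a Hopf algebra with the shuffle product, here written $\mathrm{sh}$, and the deconcatenation coproduct $\bar\Delta$; $\varepsilon$ is its counit. The Hairer--Kelly map $\psi:\mathcal H_{\mathrm{BCK}}\to T(\mathcal T)$ is the algebra morphism (forest product to shuffle product) determined recursively on trees by $\psi(\tau)=\tau+m_\otimes(\psi\otimes\mathrm{id})\Delta'\tau$, where $m_\otimes$ is concatenation of words and a tree is identified with the corresponding one-letter word. It is a Hopf algebra morphism, and every word $\tau_1\otimes\cdots\otimes\tau_k$ occurring in $\psi(\tau)$ satisfies $|\tau_1|+\dots+|\tau_k|=|\tau|$. Anisotropic geometric rough paths with exponents $\gamma|\tau|$: let $\mathfrak L$ be the (finite) set of words $v=\tau_1\otimes\cdots\otimes\tau_k$, $\tau_i\in\mathcal T_N$, $k\ge0$, with $|\tau_1|+\dots+|\tau_k|\le N$, and $\omega(v)=\gamma(|\tau_1|+\dots+|\tau_k|)$. Let $\mathcal H_{\mathrm a}$ be the span of $\mathfrak L$ (a subcoalgebra of $T(\mathcal T_N)$), so $\mathcal H_{\mathrm a}^*$ is an algebra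 for $\langle\alpha\star\beta,v\rangle=\langle\alpha\otimes\beta,\bar\Delta v\rangle$. $\mathfrak g_{\mathrm a}$ is the set of $\alpha\in\mathcal H_{\mathrm a}^*$ with $\langle\alpha,x\,\mathrm{sh}\,y\rangle=\langle\alpha,x\rangle\langle\varepsilon,y\rangle+\langle\varepsilon,x\rangle\langle\alpha,y\rangle$ whenever $x,y,x\,\mathrm{sh}\,y\in\mathcal H_{\mathrm a}$, and $G_{\mathrm a}=\{\sum_{k=0}^N\frac1{k!}\alpha^{\star k}:\alpha\in\mathfrak g_{\mathrm a}\}$. An anisotropic geometric rough path with exponents $(\gamma|\tau|)_{\tau\in\mathcal T_N}$ is a map $\bar X:[0,1]^2\to G_{\mathrm a}$ with $\bar X_{su}\star\bar X_{ut}=\bar X_{st}$ for all $s,u,t\in[0,1]$ and, for each $v\in\mathfrak L$, $|\langle\bar X_{st},v\rangle|\le C_v|t-s|^{\omega(v)}$ for all $s,t\in[0,1]$. *)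

(* Defs.v *)
From HB Require Import structures.
From mathcomp Require Import all_boot all_order all_algebra finmap.
From mathcomp Require Import monalg.
From mathcomp Require Import reals exp.
From mathcomp Require Import zify.

Set Implicit Arguments.
Unset Strict Implicit.
Unset Printing Implicit Defensive.

Import Order.TTheory GRing.Theory Num.Theory.
Local Open Scope ring_scope.

(* {malg R[K]} is the free R-module on the set K, with basis << k >>.  The    *)
(* tensor product of the free modules on K and L is the free module on K * L, *)
(* the pure tensor << k >> (x) << l >> being << (k, l) >>.                    *)

HB.lock Definition linext (R : nzRingType) (K : choiceType) (V : lmodType R)
    (f : K -> V) (x : {malg R[K]}) : V :=
  \sum_(k <- msupp x) x@_k *: f k.

Section LinearExtension.
Context (R : nzRingType) (K : choiceType) (V : lmodType R).

Lemma linextE (f : K -> V) (x : {malg R[K]}) :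
  linext f x = \sum_(k <- msupp x) x@_k *: f k.
Proof. by rewrite unlock. Qed.

Lemma linextEw (f : K -> V) (D : {fset K}) (x : {malg R[K]}) :
  (msupp x `<=` D)%fset -> linext f x = \sum_(k <- D) x@_k *: f k.
Proof.
move=> le; rewrite linextE (big_fset_incl _ le) //= => k _ /mcoeff_outdom ->.
by rewrite scale0r.
Qed.

Lemma linext_is_linear (f : K -> V) : linear (linext f).
Proof.
move=> a x y.
pose D := (msupp x `|` msupp y)%fset.
have hx : (msupp x `<=` D)%fset by apply: fsubsetUl.
have hy : (msupp y `<=` D)%fset by apply: fsubsetUr.
have hxy : (msupp (a *: x + y) `<=` D)%fset.
  apply: fsubset_trans (msuppD_le _ _) _.
  by rewrite fsubUset hy (fsubset_trans (msuppZ_le _ _) hx).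
rewrite !(linextEw _ hx, linextEw _ hy, linextEw _ hxy) scaler_sumr -big_split /=.
by apply: eq_bigr => k _; rewrite mcoeffD mcoeffZ scalerDl scalerA.
Qed.

HB.instance Definition _ (f : K -> V) :=
  GRing.isLinear.Build R {malg R[K]} V *:%R (linext f) (linext_is_linear f).

Lemma linextU (f : K -> V) (c : R) (k : K) : linext f << c *g k >> = c *: f k.
Proof. by rewrite (linextEw _ msuppU_le) big_seq_fset1 mcoeffUU. Qed.

Lemma linextU1 (f : K -> V) (k : K) : linext f << k >> = f k.
Proof. by rewrite linextU scale1r. Qed.

Lemma malgUZ (c : R) (k : K) : << c *g k >> = c *: << k >> :> {malg R[K]}.
Proof. by apply/malgP => l; rewrite mcoeffZ !mcoeffU mulr_natr. Qed.

Lemma linextP (f g : {malg R[K]} -> V) : linear f -> linear g ->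
  (forall k, f << k >> = g << k >>) -> f =1 g.
Proof.
move=> lf lg fg x.
pose f' : {linear _ -> _} := HB.pack f (GRing.isLinear.Build _ _ _ _ f lf).
pose g' : {linear _ -> _} := HB.pack g (GRing.isLinear.Build _ _ _ _ g lg).
rewrite -[f x]/(f' x) -[g x]/(g' x) [x]monalgE !raddf_sum /=.
apply: eq_bigr => k _.
rewrite malgUZ.
rewrite -[f _]/(f' _) -[g _]/(g' _) !linearZ /=; congr (_ *: _); exact: fg.
Qed.

End LinearExtension.

Section ProductMonoid.
Context (M N : monomType).
Implicit Types p q : M * N.

Definition pmone : M * N := (mone, mone).
Definition pmmul p q : M * N := (mmul p.1 q.1, mmul p.2 q.2).

Fact pmmulA : associative pmmul.
Proof. by move=> p q r; rewrite /pmmul !mulmA. Qed.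
Fact pmmul1m : left_id pmone pmmul.
Proof. by case=> x y; rewrite /pmmul !mul1m. Qed.
Fact pmmulm1 : right_id pmone pmmul.
Proof. by case=> x y; rewrite /pmmul !mulm1. Qed.
Fact pmmul_unitm p q : pmmul p q = pmone -> p = pmone /\ q = pmone.
Proof. by case: p q => [? ?] [? ?] [] /unitm[-> ->] /unitm[-> ->]. Qed.

HB.instance Definition _ := Choice_isMonomialDef.Build (M * N)%type
  pmmulA pmmul1m pmmulm1 pmmul_unitm.
End ProductMonoid.

Section ProductComMonoid.
Context (M N : conomType).
Fact pmmulC : commutative (@mmul (M * N)%type).
Proof. by case=> [a b] [c e]; congr pair; apply: mulmC. Qed.
HB.instance Definition _ := MonomialDef_isConomialDef.Build (M * N)%type pmmulC.
End ProductComMonoid.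

Section Trees.
Context (d : nat).

Inductive ptree := PNode of 'I_d & seq ptree.

Definition ptree_ind_all (P : ptree -> Prop)
    (IH : forall i s, (forall k, (k < size s)%N -> P (nth (PNode i s) s k)) ->
      P (PNode i s)) : forall t, P t :=
  fix F t := let: PNode i s := t in IH i s
    ((fix G t0 s : forall k, (k < size s)%N -> P (nth t0 s k) :=
      match s with
      | [::] => fun k h => False_ind _ (notF h)
      | u :: s' => fun k => match k with 0%N => fun _ => F u | k'.+1 => G t0 s' k' end
      end) (PNode i s) s).

Fixpoint ptree_encode (t : ptree) : GenTree.tree 'I_d :=
  let: PNode i s := t in GenTree.Node 0 (GenTree.Leaf i :: map ptree_encode s).

Fixpoint ptree_decode (t : GenTree.tree 'I_d) : option ptree :=
  match t with
  | GenTree.Node _ (GenTree.Leaf i :: s) => Some (PNode i (pmap ptree_decode s))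
  | _ => None
  end.

Fact ptree_encodeK : pcancel ptree_encode ptree_decode.
Proof.
elim/ptree_ind_all => i s IH /=; congr (Some (PNode _ _)).
have {}IH t0 k : (k < size s)%N ->
    ptree_decode (ptree_encode (nth t0 s k)) = Some (nth t0 s k).
  by move=> hk; rewrite (set_nth_default (PNode i s)) //; apply: IH.
elim: s IH => //= t s IHs IH.
rewrite (IH t 0%N) //=; congr cons; apply: IHs => t0 k hk.
exact: (IH t0 k.+1).
Qed.

HB.instance Definition _ := Countable.copy ptree (pcan_type ptree_encodeK).

Lemma ptree_ind_mem (P : ptree -> Prop) :
  (forall i s, {in s, forall u, P u} -> P (PNode i s)) -> forall t, P t.
Proof.
move=> H; elim/ptree_ind_all => i s IH; apply: H => u us.
by rewrite -(nth_index (PNode i s) us); apply: IH; rewrite index_mem.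
Qed.

Definition ptree_le (t u : ptree) := (choice.pickle t <= choice.pickle u)%N.

Fact ptree_le_total : total ptree_le. Proof. by move=> t u; apply: leq_total. Qed.
Fact ptree_le_trans : transitive ptree_le.
Proof. by move=> t u v; apply: leq_trans. Qed.
Fact ptree_le_anti : antisymmetric ptree_le.
Proof.
move=> t u; rewrite -eqn_leq => /eqP h.
exact: (pcan_inj choice.pickleK).
Qed.

(* Two planar trees have the same underlying non-planar tree exactly when they *)
(* have the same normal form, so non-planar trees are planar normal forms.     *)
Fixpoint nf (t : ptree) : ptree :=
  let: PNode i s := t in PNode i (sort ptree_le (map nf s)).

Lemma nf_idem t : nf (nf t) = nf t.
Proof.
elim/ptree_ind_mem: t => i s IH /=; congr PNode.
have -> : map nf (sort ptree_le (map nf s)) = sort ptree_le (map nf s).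
  rewrite -[RHS]map_id; apply/eq_in_map => u; rewrite mem_sort => /mapP[v vs ->].
  exact: IH.
by rewrite sorted_sort //; [exact: ptree_le_trans | exact: sort_sorted ptree_le_total _].
Qed.

Lemma nf_perm i s s' :
  perm_eq (map nf s) (map nf s') -> nf (PNode i s) = nf (PNode i s').
Proof.
move=> h /=; congr PNode; apply/perm_sortP => //.
- exact: ptree_le_total.
- exact: ptree_le_trans.
- exact: ptree_le_anti.
Qed.

Record tree := Tree { tval : ptree; _ : nf tval == tval }.
HB.instance Definition _ := [isSub for tval].
HB.instance Definition _ := [Countable of tree by <:].

Lemma tree_nf (t : tree) : nf (tval t) = tval t.
Proof. exact/eqP/(valP t). Qed.

Definition unplanar (t : ptree) : tree := Tree (introT eqP (nf_idem t)).

Lemma unplanarK (t : tree) : unplanar (tval t) = t.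
Proof. by apply: val_inj; rewrite /= tree_nf. Qed.

Lemma nfE i s : nf (PNode i s) = PNode i (sort ptree_le (map nf s)).
Proof. by []. Qed.

Lemma unplanar_nf t : unplanar (nf t) = unplanar t.
Proof. by apply: val_inj; apply: nf_idem. Qed.

(* {cmonom tree} is the free commutative monoid on trees, that is, the finite  *)
(* multisets of trees with disjoint union; the tree t is the forest ucm t.     *)
Definition forest := {cmonom tree}.
HB.instance Definition _ := ConomialDef.on forest.

Definition ftrees (f : forest) : seq tree :=
  flatten [seq nseq (f t) t | t <- finsupp f].

Lemma count_ftrees (f : forest) t : count_mem t (ftrees f) = f t.
Proof.
rewrite /ftrees count_flatten -map_comp.
rewrite (eq_map (g := fun u => (u == t) * f u)%N); last first.
  by move=> u /=; rewrite count_nseq.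
rewrite sumnE big_map; case: (finsuppP f t) => ht.
  rewrite big_seq big1 // => u hu.
  by case: eqP hu ht => [->|_ _ _]; [move=> ->|rewrite mul0n].
rewrite (big_fsetD1 t) //= eqxx mul1n big_seq big1 ?addn0 // => u.
by rewrite in_fsetD1 => /andP[/negPf->]; rewrite mul0n.
Qed.

Lemma ftreesM f g : perm_eq (ftrees (mmul f g)) (ftrees f ++ ftrees g).
Proof. by apply/allP => t _; rewrite /= count_cat !count_ftrees cmM. Qed.

Lemma ftrees1 : ftrees mone = [::].
Proof. by rewrite /ftrees mdom1. Qed.

Lemma ftreesU t : ftrees (ucm t) = [:: t].
Proof.
apply: perm_small_eq => //; apply/allP => u _ /=.
by rewrite count_ftrees cmU eq_sym addn0.
Qed.

Lemma ftreesI f g : perm_eq (ftrees f) (ftrees g) -> f = g.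
Proof.
move=> /permP h; apply/eqP/cmP => t; by rewrite -!count_ftrees h.
Qed.

Lemma ftrees_prod (s : seq tree) :
  perm_eq (ftrees (\big[mmul/mone]_(t <- s) ucm t)) s.
Proof.
elim: s => [|t s IH]; first by rewrite big_nil ftrees1.
rewrite big_cons (permPl (ftreesM _ _)) ftreesU /= perm_cons; exact: IH.
Qed.

(* [tau_1 ... tau_k]_i *)
Definition graft (i : 'I_d) (f : forest) : tree :=
  unplanar (PNode i (map tval (ftrees f))).

Lemma tval_graft i f : tval (graft i f) = nf (PNode i (map tval (ftrees f))).
Proof. by []. Qed.

Definition label (t : tree) : 'I_d := let: PNode i _ := tval t in i.
Definition branches (t : tree) : forest :=
  let: PNode _ s := tval t in \big[mmul/mone]_(u <- s) ucm (unplanar u).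

Lemma map_nf_tval (s : seq tree) : map nf (map tval s) = map tval s.
Proof. by rewrite -map_comp; apply: eq_map => t /=; rewrite tree_nf. Qed.

Lemma graft_label_branches t : graft (label t) (branches t) = t.
Proof.
apply: val_inj; rewrite /graft /label /branches [val _]/= [val t]/=.
move: (tree_nf t); case: (tval t) => i s h; rewrite -[RHS]h.
apply: nf_perm; rewrite map_nf_tval.
rewrite -(big_map unplanar xpredT (@ucm _)).
rewrite (permPl (perm_map _ (ftrees_prod _))) -map_comp.
by rewrite (eq_map (g := nf)).
Qed.

Lemma label_graft i f : label (graft i f) = i.
Proof. by []. Qed.

Lemma branches_graft i f : branches (graft i f) = f.
Proof.
apply: ftreesI; rewrite /branches /= map_nf_tval.
rewrite -(big_map unplanar xpredT (@ucm _)) (permPl (ftrees_prod _)).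
have h : map unplanar (map tval (ftrees f)) = ftrees f.
  by rewrite -map_comp -[RHS]map_id; apply: eq_map => t /=; rewrite unplanarK.
by rewrite -[X in perm_eq _ X]h; apply: perm_map; rewrite perm_sort.
Qed.

Fixpoint pnodes (t : ptree) : nat :=
  let: PNode _ s := t in (sumn (map pnodes s)).+1.

Definition tnodes (t : tree) : nat := pnodes (tval t).
Definition fnodes (f : forest) : nat := \sum_(t <- ftrees f) tnodes t.

Lemma pnodes_nf t : pnodes (nf t) = pnodes t.
Proof.
elim/ptree_ind_mem: t => i s IH /=; congr _.+1.
have /(perm_map pnodes)/perm_sumn -> : perm_eq (sort ptree_le (map nf s)) (map nf s).
  by rewrite perm_sort.
by rewrite -map_comp; congr sumn; apply/eq_in_map => u us /=; apply: IH.
Qed.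

Lemma tnodes_unplanar t : tnodes (unplanar t) = pnodes t.
Proof. exact: pnodes_nf. Qed.

Lemma tnodes_graft i f : tnodes (graft i f) = (fnodes f).+1.
Proof.
by rewrite /tnodes [tval _]/= -/(nf (PNode _ _)) pnodes_nf /= -map_comp sumnE big_map.
Qed.

Lemma tnodes_gt0 t : (0 < tnodes t)%N.
Proof. by rewrite /tnodes; case: (tval t). Qed.

Lemma fnodesM f g : fnodes (mmul f g) = (fnodes f + fnodes g)%N.
Proof. by rewrite /fnodes (perm_big _ (ftreesM f g)) big_cat. Qed.

Lemma fnodesU t : fnodes (ucm t) = tnodes t.
Proof. by rewrite /fnodes ftreesU big_seq1. Qed.

Lemma fnodes1 : fnodes mone = 0%N.
Proof. by rewrite /fnodes ftrees1 big_nil. Qed.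

End Trees.

Notation BCK R d := {malg R[forest d]}.
Notation BCK2 R d := {malg R[(forest d * forest d)%type]}.

Section Coproduct.
Context (R : realType) (d : nat).
Implicit Types (t u : tree d) (f g : forest d) (p : forest d * forest d).

(* id (x) [ . ]_i *)
Definition graft_right (i : 'I_d) : BCK2 R d -> BCK2 R d :=
  linext (fun p => << (p.1, ucm (graft i p.2)) >>).
HB.instance Definition _ i := GRing.Linear.on (graft_right i).

Fixpoint pcoprod (t : ptree d) : BCK2 R d :=
  let: PNode i s := t in
  << (ucm (unplanar t), mone) >> + graft_right i (\prod_(x <- map pcoprod s) x).

Definition fcoprod (f : forest d) : BCK2 R d :=
  \prod_(t <- ftrees f) pcoprod (tval t).

Definition coprod : BCK R d -> BCK2 R d := linext fcoprod.
HB.instance Definition _ := GRing.Linear.copy coprod (linext fcoprod).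

Lemma pcoprodE i s : pcoprod (PNode i s) =
  << (ucm (unplanar (PNode i s)), mone) >> + graft_right i (\prod_(t <- s) pcoprod t).
Proof. by rewrite -(big_map pcoprod xpredT id). Qed.

Lemma pcoprod_nf (t : ptree d) : pcoprod (nf t) = pcoprod t.
Proof.
elim/ptree_ind_mem: t => i s IH; rewrite [nf _]nfE !pcoprodE.
have -> : unplanar (PNode i (sort (@ptree_le d) (map (@nf d) s))) = unplanar (PNode i s).
  by rewrite -nfE unplanar_nf.
have -> : \prod_(t <- sort (@ptree_le d) (map (@nf d) s)) pcoprod t =
          \prod_(t <- s) pcoprod t; last by [].
rewrite (perm_big (map (@nf d) s)) ?perm_sort // big_map.
by apply: eq_big_seq => u us; apply: IH.
Qed.

Lemma coprodU f : coprod << f >> = fcoprod f.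
Proof. exact: linextU1. Qed.

Lemma fcoprodM f g : fcoprod (mmul f g) = fcoprod f * fcoprod g.
Proof. by rewrite /fcoprod (perm_big _ (ftreesM f g)) big_cat. Qed.

(* The coproduct is the algebra morphism defined by the recursion on trees. *)
Lemma coprod_graft i f :
  coprod << ucm (graft i f) >> =
    << (ucm (graft i f), mone) >> + graft_right i (coprod << f >>).
Proof.
rewrite [LHS]coprodU.
rewrite (coprodU f).
rewrite {1}/fcoprod.
rewrite ftreesU.
rewrite big_seq1.
rewrite tval_graft.
rewrite pcoprod_nf.
rewrite pcoprodE.
rewrite big_map.
done.
Qed.

Lemma coprod1 : coprod 1 = 1.
Proof. by rewrite coprodU /fcoprod ftrees1 big_nil. Qed.

Lemma coprodM x y : coprod (x * y) = coprod x * coprod y.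
Proof.
have L (a b : BCK R d) :
    (a * b) = \sum_(k <- msupp a) \sum_(l <- msupp b) (a@_k * b@_l) *: << mmul k l >>.
  rewrite malgME; apply: eq_bigr => k _; apply: eq_bigr => l _.
  exact: malgUZ.
transitivity (\sum_(k <- msupp x) \sum_(l <- msupp y)
    (x@_k * y@_l) *: (fcoprod k * fcoprod l)).
  rewrite L linear_sum; apply: eq_bigr => k _.
  rewrite linear_sum; apply: eq_bigr => l _; rewrite linearZ; congr (_ *: _).
  by rewrite [LHS]coprodU fcoprodM.
rewrite /coprod !linextE mulr_suml; apply: eq_bigr => k _.
rewrite mulr_sumr; apply: eq_bigr => l _.
by rewrite -scalerAl -scalerAr scalerA.
Qed.

(* Delta' on trees *)
Definition red_coprod (t : tree d) : BCK2 R d :=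
  coprod << ucm t >> - << (ucm t, mone) >> - << (mone, ucm t) >>.

Definition graded2 n (x : BCK2 R d) :=
  {in msupp x, forall p, (fnodes p.1 + fnodes p.2)%N = n}.

Lemma graded2M m n x y : graded2 m x -> graded2 n y -> graded2 (m + n) (x * y).
Proof.
move=> hx hy p /msuppM_le[q [r [/hx hq /hy hr ->]]] /=.
by rewrite !fnodesM -hq -hr addnACA.
Qed.

Lemma graft_right_supp i x p : p \in msupp (graft_right i x) ->
  exists2 q, q \in msupp x & p = (q.1, ucm (graft i q.2)).
Proof.
case: (boolP (has (fun q => p == (q.1, ucm (graft i q.2))) (msupp x))).
  by case/hasP=> q hq /eqP ->; exists q.
move=> /hasPn hn; rewrite -mcoeff_neq0 /graft_right linextE raddf_sum big_seq big1 ?eqxx //.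
by move=> q /hn hq; rewrite [LHS]mcoeffZ mcoeffU eq_sym (negPf hq) mulr0.
Qed.

Lemma graft_right_graded n i x :
  graded2 n x -> graded2 n.+1 (graft_right i x).
Proof.
move=> hx p /graft_right_supp[q /hx <- ->].
by rewrite fnodesU tnodes_graft addnS.
Qed.

Lemma prod_graded (I : eqType) (s : seq I) (n : I -> nat) (F : I -> BCK2 R d) :
  {in s, forall k, graded2 (n k) (F k)} ->
  graded2 (\sum_(k <- s) n k) (\prod_(k <- s) F k).
Proof.
elim: s => [|k s IH] h; first by rewrite !big_nil => p; rewrite msuppU1 in_fset1 => /eqP ->; rewrite !fnodes1.
rewrite !big_cons; apply: graded2M; first by apply: h; rewrite inE eqxx.
by apply: IH => l ls; apply: h; rewrite inE ls orbT.
Qed.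

Lemma pcoprod_graded (t : ptree d) : graded2 (pnodes t) (pcoprod t).
Proof.
elim/ptree_ind_mem: t => i s IH p; rewrite pcoprodE.
move=> /(fsubsetP (msuppD_le _ _)); rewrite in_fsetU => /orP[|].
  by rewrite msuppU1 in_fset1 => /eqP ->; rewrite fnodesU fnodes1 addn0 tnodes_unplanar.
have -> : pnodes (PNode i s) = (\sum_(u <- s) pnodes u).+1 by rewrite /= sumnE big_map.
by apply: graft_right_graded; apply: prod_graded.
Qed.

(* For a tree tau, Delta' tau is a sum of terms (forest) (x) (tree). *)
Lemma red_coprod_supp t p : p \in msupp (red_coprod t) ->
  (fnodes p.1 < tnodes t)%N /\ exists u, p.2 = ucm u.
Proof.
pose i := label t; pose x := \prod_(u <- ftrees (branches t)) pcoprod (tval u).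
have e : coprod << ucm t >> = << (ucm t, mone) >> + graft_right i x.
  by rewrite -{1 2}(graft_label_branches t) coprod_graft coprodU.
have gx : graded2 (tnodes t) (graft_right i x).
  rewrite -(graft_label_branches t) tnodes_graft; apply: graft_right_graded.
  by apply: prod_graded => u _; apply: pcoprod_graded.
rewrite /red_coprod e [X in X - _ - _]addrC addrK.
move=> /(fsubsetP (msuppD_le _ _)); rewrite in_fsetU msuppN => /orP[hp|].
  have := gx _ hp; have [q _ ->] := graft_right_supp hp; rewrite [(_, _).2]/= => <-.
  by split; [rewrite fnodesU -addn1 leq_add2l tnodes_gt0 | eexists].
rewrite msuppU1 in_fset1 => /eqP ->; split; last by exists t.
by rewrite fnodes1 tnodes_gt0.
Qed.

End Coproduct.

(* Associativity of the shuffle product on words a u, b v, c w, from the three *)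
(* instances with one letter removed; L, M, N prepend a, b, c.                 *)
Fact shuffle_assoc_step (V : zmodType) (sh : V -> V -> V) (L M N : V -> V)
    (x y z p q r : V) :
  left_distributive sh +%R -> right_distributive sh +%R ->
  (forall s t, L (s + t) = L s + L t) -> (forall s t, N (s + t) = N s + N t) ->
  (forall s t, sh (L s) (M t) = L (sh s (M t)) + M (sh (L s) t)) ->
  (forall s t, sh (L s) (N t) = L (sh s (N t)) + N (sh (L s) t)) ->
  (forall s t, sh (M s) (N t) = M (sh s (N t)) + N (sh (M s) t)) ->
  p = L x -> q = M y -> r = N z ->
  sh x (sh q r) = sh (sh x q) r ->
  sh p (sh y r) = sh (sh p y) r ->
  sh p (sh q z) = sh (sh p q) z ->
  sh p (sh q r) = sh (sh p q) r.
Proof.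
move=> Dl Dr LD ND LM LN MN -> -> -> h1 h2 h3.
transitivity (L (sh (sh x (M y)) (N z)) +
  (M (sh (sh (L x) y) (N z)) + N (sh (sh (L x) (M y)) z))).
  by rewrite -h1 -h2 -h3 [in LHS]MN [LHS]Dr [X in X + _ = _]LM [X in _ + X = _]LN addrACA -LD -Dr MN.
by rewrite [in RHS]LM [RHS]Dl [X in _ = X + _]LN [X in _ = _ + X]MN [RHS]addrACA -ND -Dl -LM addrA.
Qed.

Notation TA R A := {malg R[{fmonom A}]}.

Section ShuffleDef.
Context (R : realType) (A : choiceType).

Definition letter (a : A) : TA R A := << fmu a >>.

(* The ring product of TA R A is concatenation of words. *)
Fixpoint shuffle_seq (u : seq A) : seq A -> TA R A :=
  fix shuffle_v v := match u, v with
  | [::], _ => << FMonom v >>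
  | _, [::] => << FMonom u >>
  | a :: u', b :: v' =>
      letter a * shuffle_seq u' v + letter b * shuffle_v v'
  end.

End ShuffleDef.

HB.lock Definition shuffle (R : realType) (A : choiceType) (x y : TA R A) : TA R A :=
  linext (fun u : {fmonom A} => linext (fun v : {fmonom A} => shuffle_seq R u v) y) x.
Arguments shuffle {R A} x y.

Section Shuffle.
Context (R : realType) (A : choiceType).
Implicit Types (a b c : A) (u v w : seq A) (x y z : TA R A).

Lemma shuffle_def x y : shuffle x y =
  linext (fun u : {fmonom A} => linext (fun v : {fmonom A} => shuffle_seq R u v) y) x.
Proof. by rewrite unlock. Qed.

(* The coefficient of the empty word. *)
Definition counit (x : TA R A) : R := x@_mone.

Local Notation "x ** y" := (shuffle x y) (at level 40, left associativity).
Local Notation "<| u |>" := (<< FMonom u >> : TA R A) (at level 0).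

Lemma shuffle_seqs0 u : shuffle_seq R u [::] = <| u |>.
Proof. by case: u. Qed.

Lemma shuffle_seq0s v : shuffle_seq R [::] v = <| v |>.
Proof. by case: v. Qed.

Lemma shuffle_seq_cons a u b v : shuffle_seq R (a :: u) (b :: v) =
  letter R a * shuffle_seq R u (b :: v) + letter R b * shuffle_seq R (a :: u) v.
Proof. by []. Qed.

Lemma letter_word a u : letter R a * <| u |> = <| a :: u |>.
Proof.
rewrite /letter [LHS]malgM_def fgmulUU mulr1; congr << _ >>.
by apply/eqP; rewrite fmP fmM fmU.
Qed.

Lemma shuffleE u v : <| u |> ** <| v |> = shuffle_seq R u v.
Proof. by rewrite shuffle_def !linextU1. Qed.

Lemma shuffle_linear_l y : linear (shuffle^~ y).
Proof. by move=> k x z; rewrite !shuffle_def linearP. Qed.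

Lemma shuffle_linear_r x : linear (shuffle x).
Proof.
move=> k y z; rewrite !shuffle_def !(linextE _ x) scaler_sumr -big_split.
by apply: eq_bigr => u _; rewrite linearP scalerDr scalerA mulrC -scalerA.
Qed.

HB.instance Definition _ x :=
  GRing.isLinear.Build R (TA R A) (TA R A) *:%R (shuffle x) (shuffle_linear_r x).

Lemma shuffleDl : left_distributive (@shuffle R A) +%R.
Proof. move=> x y z; by have := shuffle_linear_l z 1 x y; rewrite !scale1r. Qed.

Lemma shuffleDr : right_distributive (@shuffle R A) +%R.
Proof. by move=> x y z; rewrite linearD. Qed.

Lemma wordP (f g : TA R A -> TA R A) : linear f -> linear g ->
  (forall u, f <| u |> = g <| u |>) -> f =1 g.
Proof. by move=> lf lg fg; apply: linextP => // -[u]; apply: fg. Qed.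

Lemma mulr_scaleA (k : R) x y : x * (k *: y) = k *: (x * y).
Proof.
rewrite (malgMEw (fsubset_refl _) (msuppZ_le _ _)) malgME scaler_sumr.
apply: eq_bigr => u _; rewrite scaler_sumr; apply: eq_bigr => v _.
by rewrite mcoeffZ [LHS]malgUZ [in RHS]malgUZ scalerA mulrCA.
Qed.

Lemma mulr_linear x : linear (fun y => x * y).
Proof. by move=> k y z; rewrite mulrDr mulr_scaleA. Qed.

Lemma linear_comp2 (f g : TA R A -> TA R A) :
  linear f -> linear g -> linear (fun x => f (g x)).
Proof. by move=> lf lg k x y; rewrite lg lf. Qed.

Lemma linear_add2 (f g : TA R A -> TA R A) :
  linear f -> linear g -> linear (fun x => f x + g x).
Proof. by move=> lf lg k x y; rewrite lg lf scalerDr addrACA. Qed.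

(* The recursion of shuffle_seq, for arbitrary elements of TA R A. *)
Lemma shuffle_letter a x b y : (letter R a * x) ** (letter R b * y) =
  letter R a * (x ** (letter R b * y)) + letter R b * ((letter R a * x) ** y).
Proof.
move: x; apply: wordP.
- exact: linear_comp2 (shuffle_linear_l _) (mulr_linear _).
- apply: linear_add2; first exact: linear_comp2 (mulr_linear _) (shuffle_linear_l _).
  apply: (linear_comp2 (mulr_linear _)).
  exact: linear_comp2 (shuffle_linear_l _) (mulr_linear _).
move=> u; move: y; apply: wordP.
- exact: linear_comp2 (shuffle_linear_r _) (mulr_linear _).
- apply: linear_add2; last exact: linear_comp2 (mulr_linear _) (shuffle_linear_r _).
  apply: (linear_comp2 (mulr_linear _)).
  exact: linear_comp2 (shuffle_linear_r _) (mulr_linear _).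
move=> v; rewrite (letter_word a) (letter_word b) [LHS]shuffleE shuffle_seq_cons.
by rewrite -[shuffle_seq R u _]shuffleE -[shuffle_seq R _ v]shuffleE.
Qed.

Lemma shuffle_seqC u v : shuffle_seq R u v = shuffle_seq R v u.
Proof.
elim: u v => [|a u IHu] v; first by rewrite shuffle_seqs0 shuffle_seq0s.
elim: v => [|b v IHv]; first by rewrite shuffle_seqs0 shuffle_seq0s.
by rewrite !shuffle_seq_cons IHv IHu addrC.
Qed.

Lemma shuffleC x y : x ** y = y ** x.
Proof.
move: x; apply: wordP; [exact: shuffle_linear_l|exact: shuffle_linear_r|move=> u].
move: y; apply: wordP; [exact: shuffle_linear_r|exact: shuffle_linear_l|move=> v].
by rewrite [LHS]shuffleE [RHS]shuffleE shuffle_seqC.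
Qed.

Lemma one_word : 1 = <| [::] |>.
Proof. by congr << _ >>; apply/eqP; rewrite fmP fm1. Qed.

Lemma shuffle1x x : 1 ** x = x.
Proof.
move: x; apply: wordP; [exact: shuffle_linear_r|by []|move=> u].
by rewrite one_word [LHS]shuffleE shuffle_seq0s.
Qed.

Lemma shufflex1 x : x ** 1 = x.
Proof. by rewrite shuffleC shuffle1x. Qed.

Lemma shuffle_seqA n u v w : (size u + size v + size w <= n)%N ->
  <| u |> ** (<| v |> ** <| w |>) = (<| u |> ** <| v |>) ** <| w |>.
Proof.
elim: n u v w => [|n IH] [|a u] [|b v] [|c w] // h;
  rewrite -?one_word ?(shuffle1x, shufflex1) //.
rewrite -(letter_word a) -(letter_word b) -(letter_word c).
apply: (@shuffle_assoc_step _ (@shuffle R A) (fun x => letter R a * x)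
  (fun x => letter R b * x) (fun x => letter R c * x) <| u |> <| v |> <| w |>).
- exact: shuffleDl.
- exact: shuffleDr.
- exact: mulrDr.
- exact: mulrDr.
- by move=> x y; apply: shuffle_letter.
- by move=> x y; apply: shuffle_letter.
- by move=> x y; apply: shuffle_letter.
- by [].
- by [].
- by [].
- by rewrite (letter_word b) (letter_word c); apply: IH; move: h; rewrite /=; lia.
- by rewrite (letter_word a) (letter_word c); apply: IH; move: h; rewrite /=; lia.
- by rewrite (letter_word a) (letter_word b); apply: IH; move: h; rewrite /=; lia.
Qed.

Lemma shuffleA x y z : x ** (y ** z) = (x ** y) ** z.
Proof.
move: x; apply: wordP.
- exact: shuffle_linear_l.
- exact: linear_comp2 (shuffle_linear_l _) (shuffle_linear_l _).
move=> u; move: y; apply: wordP.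
- exact: linear_comp2 (shuffle_linear_r _) (shuffle_linear_l _).
- exact: linear_comp2 (shuffle_linear_l _) (shuffle_linear_r _).
move=> v; move: z; apply: wordP.
- exact: linear_comp2 (shuffle_linear_r _) (shuffle_linear_r _).
- exact: shuffle_linear_r.
by move=> w; apply: (shuffle_seqA (leqnn _)).
Qed.

HB.instance Definition _ :=
  Monoid.isComLaw.Build (TA R A) 1 shuffle shuffleA shuffleC shuffle1x.

End Shuffle.

Section HairerKelly.
Context (R : realType) (d : nat).
Implicit Types (t u : tree d) (f g : forest d).

(* Identification of a tree with a one-letter word. *)
Definition tree_letter (f : forest d) : TA R (tree d) :=
  if ftrees f is [:: t] then letter R t else 0.

(* m (phi (x) id), where phi is given on the basis of forests *)
Definition concat_left (phi : forest d -> TA R (tree d)) :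
    BCK2 R d -> TA R (tree d) :=
  linext (fun p => phi p.1 * tree_letter p.2).

(* The recursion terminates because Delta' lowers the number of nodes; n bounds *)
(* this number.                                                                 *)
Fixpoint hk_rec (n : nat) (t : tree d) : TA R (tree d) :=
  if n is n'.+1 then
    letter R t +
      concat_left (fun f => \big[shuffle/1]_(u <- ftrees f) hk_rec n' u)
        (red_coprod R t)
  else 0.

Lemma hk_recS n t : hk_rec n.+1 t = letter R t +
  concat_left (fun f => \big[shuffle/1]_(u <- ftrees f) hk_rec n u) (red_coprod R t).
Proof. by []. Qed.

Definition hk_tree (t : tree d) := hk_rec (tnodes t) t.

Definition hk_forest (f : forest d) : TA R (tree d) :=
  \big[shuffle/1]_(t <- ftrees f) hk_tree t.

Definition hairer_kelly : BCK R d -> TA R (tree d) := linext hk_forest.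
HB.instance Definition _ := GRing.Linear.copy hairer_kelly (linext hk_forest).

Lemma hairer_kellyU f : hairer_kelly << f >> = hk_forest f.
Proof. exact: linextU1. Qed.

Lemma tnodes_in f u : u \in ftrees f -> (tnodes u <= fnodes f)%N.
Proof. by move=> uf; rewrite /fnodes (big_rem u) //= leq_addr. Qed.

Lemma concat_left_eq phi phi' (x : BCK2 R d) :
  {in msupp x, forall p, phi p.1 = phi' p.1} -> concat_left phi x = concat_left phi' x.
Proof.
move=> h; rewrite /concat_left !linextE [LHS]big_seq [RHS]big_seq.
by apply: eq_bigr => p /h ->.
Qed.

Lemma hk_rec_stable m n t : (tnodes t <= m)%N -> (tnodes t <= n)%N ->
  hk_rec m t = hk_rec n t.
Proof.
elim: m n t => [|m IH] n t hm hn; first by have := leq_trans (tnodes_gt0 t) hm.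
case: n hn => [|n] hn; first by have := leq_trans (tnodes_gt0 t) hn.
congr (_ + _); apply: concat_left_eq => p /red_coprod_supp[hp _].
apply: eq_big_seq => u /tnodes_in hu; apply: IH.
  by rewrite -ltnS (leq_ltn_trans hu) // (leq_trans hp).
by rewrite -ltnS (leq_ltn_trans hu) // (leq_trans hp).
Qed.

(* The Hairer-Kelly map is the morphism from the forest product to the shuffle *)
(* product determined by the recursion on trees.                               *)
Lemma hairer_kelly_tree t : hairer_kelly << ucm t >> =
  letter R t + concat_left (fun f => hairer_kelly << f >>) (red_coprod R t).
Proof.
rewrite [LHS]hairer_kellyU /hk_forest ftreesU big_seq1 /hk_tree.
case E : (tnodes t) => [|n]; first by move: (tnodes_gt0 t); rewrite E.
rewrite hk_recS; apply: (congr1 (fun x => letter R t + x)); apply: concat_left_eq => p /red_coprod_supp[hp _].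
rewrite [RHS]hairer_kellyU; apply: eq_big_seq => u /tnodes_in hu.
by apply: hk_rec_stable => //; rewrite -ltnS -E (leq_ltn_trans hu).
Qed.

Lemma hk_forestM f g : hk_forest (mmul f g) = shuffle (hk_forest f) (hk_forest g).
Proof. by rewrite /hk_forest (perm_big _ (ftreesM f g)) big_cat. Qed.

Lemma hairer_kelly1 : hairer_kelly 1 = 1.
Proof. by rewrite [LHS]hairer_kellyU /hk_forest ftrees1 big_nil. Qed.

Lemma hairer_kellyM x y :
  hairer_kelly (x * y) = shuffle (hairer_kelly x) (hairer_kelly y).
Proof.
move: x; apply: linextP.
- by move=> k x z; rewrite mulrDl -scalerAl linearP.
- by move=> k x z; rewrite linearP shuffle_linear_l.
move=> f; move: y; apply: linextP.
- by move=> k x z; rewrite mulrDr -scalerAr linearP.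
- by move=> k x z; rewrite linearP shuffle_linear_r.
move=> g; transitivity (hk_forest (mmul f g)).
  rewrite -[RHS]hairer_kellyU; apply: (congr1 hairer_kelly).
  by rewrite [LHS]malgM_def fgmulUU mulr1.
rewrite hk_forestM; apply: (congr2 shuffle); symmetry; exact: hairer_kellyU.
Qed.

End HairerKelly.

Section Duality.
Context (R : realType) (K : choiceType).
Implicit Types (D : {malg R[K]} -> {malg R[(K * K)%type]}) (a b : {malg R[K]} -> R).

(* <a * b, x> = <a (x) b, D x> for a coproduct D *)
Definition conv D a b (x : {malg R[K]}) : R :=
  linext (fun p => a << p.1 >> * b << p.2 >> : R^o) (D x).

End Duality.

Section BranchedRoughPath.
Context (R : realType) (d : nat).

Definition is_character (X : {scalar (BCK R d)}) :=
  (exists x, X x != 0) /\ (forall x y, X (x * y) = X x * X y).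

(* Only the values of X on [0, 1]^2 matter. *)
Definition branched_rough_path (gamma : R) (X : R -> R -> {scalar (BCK R d)}) :=
  [/\ {in `[0, 1] &, forall s t, is_character (X s t)},
      {in `[0, 1] & &, forall s u t,
        conv (@coprod R d) (X s u) (X u t) =1 X s t}
    & forall f : forest d, exists C : R, {in `[0, 1] &, forall s t,
        `|X s t << f >>| <= C * `|t - s| `^ (gamma * (fnodes f)%:R)}].

End BranchedRoughPath.

Section Anisotropic.
Context (R : realType) (d N : nat).

Definition wnodes (w : seq (tree d)) : nat := \sum_(t <- w) tnodes t.

Definition in_aword (w : seq (tree d)) :=
  all (fun t => tnodes t <= N)%N w && (wnodes w <= N)%N.

(* Words on trees with at most N nodes, of total weight at most N.  The space *)
(* Ha they span is free on this type; Ha_incl embeds it in the words on all    *)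
(* trees, where the shuffle product and the Hairer-Kelly map take values.      *)
Record aword := AWord { aval : seq (tree d); _ : in_aword aval }.
HB.instance Definition _ := [isSub for aval].
HB.instance Definition _ := [Choice of aword by <:].

Fact in_aword_cat u v : in_aword (u ++ v) -> in_aword u && in_aword v.
Proof.
rewrite /in_aword /wnodes all_cat big_cat /= => /andP[/andP[-> ->] h].
by rewrite (leq_trans _ h) ?leq_addr // (leq_trans _ h) ?leq_addl.
Qed.

Fact in_aword_take k (w : aword) : in_aword (take k (aval w)).
Proof.
have h : in_aword (take k (aval w) ++ drop k (aval w)).
  by rewrite cat_take_drop; apply: valP.
by case/andP: (in_aword_cat h).
Qed.

Fact in_aword_drop k (w : aword) : in_aword (drop k (aval w)).
Proof.
have h : in_aword (take k (aval w) ++ drop k (aval w)).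
  by rewrite cat_take_drop; apply: valP.
by case/andP: (in_aword_cat h).
Qed.

Definition atake k w := AWord (in_aword_take k w).
Definition adrop k w := AWord (in_aword_drop k w).

Local Notation Ha := {malg R[aword]}.

Definition deconcat : Ha -> {malg R[(aword * aword)%type]} :=
  linext (fun w => \sum_(k < (size (aval w)).+1) << (atake k w, adrop k w) >>).

Definition Ha_incl : Ha -> TA R (tree d) := linext (fun w => << FMonom (aval w) >>).

Lemma Ha_inclE (x : Ha) (w : aword) : (Ha_incl x)@_(FMonom (aval w)) = x@_w.
Proof.
rewrite /Ha_incl linextE [in RHS](monalgE x) !raddf_sum /=.
apply: eq_bigr => v _; rewrite [LHS]mcoeffZ !mcoeffU mulr_natr.
congr (_ *+ nat_of_bool _); apply/eqP/eqP => [[] /val_inj|->] //.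
Qed.

Lemma Ha_incl_inj : injective Ha_incl.
Proof. by move=> x y e; apply/malgP => w; rewrite -!Ha_inclE e. Qed.

Definition Ha_counit (x : Ha) : R := counit (Ha_incl x).

(* The hypothesis says that the shuffle of x and y lies in Ha, and is z there. *)
Definition in_ga (a : {scalar Ha}) :=
  forall x y z : Ha, shuffle (Ha_incl x) (Ha_incl y) = Ha_incl z ->
    a z = a x * Ha_counit y + Ha_counit x * a y.

Definition conv_exp k (a : Ha -> R) : Ha -> R := iter k (conv deconcat a) Ha_counit.

Definition in_Ga (g : {scalar Ha}) :=
  exists2 a : {scalar Ha}, in_ga a &
    forall x, g x = \sum_(k < N.+1) (k`!%:R)^-1 * conv_exp k a x.

(* Only the values of X on [0, 1]^2 matter. *)
Definition anisotropic_rough_path (gamma : R) (X : R -> R -> {scalar Ha}) :=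
  [/\ {in `[0, 1] &, forall s t, in_Ga (X s t)},
      {in `[0, 1] & &, forall s u t,
        conv deconcat (X s u) (X u t) =1 X s t}
    & forall w : aword, exists C : R, {in `[0, 1] &, forall s t,
        `|X s t << w >>| <= C * `|t - s| `^ (gamma * (wnodes (aval w))%:R)}].

End Anisotropic.

(* Main.v *)
(** The path is built by induction on the weight n.  Given a truncated character
    Y_st of the shuffle algebra on words of weight at most n, satisfying Chen's
    relation and the Hoelder bounds, set Z_st = exp(log Y_st), where log Y_st has no
    component of weight n + 1.  In weight n + 1 the defect
    c(s,u,t) = Z_su * Z_ut - Z_st is an additive cocycle with values in the primitive
    elements, of size |t - s|^(gamma (n + 1)).  As gamma (n + 1) < 1, such a cocycle
    is the coboundary of some h_st of the same size: following Lyons and Victoir, h is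
    chosen on dyadic points by giving equal increments to both halves of each dyadic
    interval.  This choice is linear in c, so that h is primitive and Z + h is again
    a character.  Finally psi(t) is the letter t plus longer words, so the remaining
    additive discrepancy X_st(t) - <Z_st + h_st, psi(t)> for the trees t with n + 1
    nodes can be absorbed into the one-letter words. *)

Require Import Defs.
From HB Require Import structures.
From mathcomp Require Import all_boot all_order all_algebra finmap.
From mathcomp Require Import monalg boolp classical_sets reals topology normedtype sequences exp.
From mathcomp Require Import zify ring lra.

Set Implicit Arguments.
Unset Strict Implicit.
Unset Printing Implicit Defensive.

Import Order.TTheory GRing.Theory Num.Theory.
Local Open Scope ring_scope.

(** For exponents below 1 nothing like a sewing lemma is available: nonzero additive functions of
    the interval can have size |t - s|^(gamma (n + 1)), so the lower weights do not determine the
    next one. A primitive has to be chosen word by word; unrelated choices would break the shuffle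
    relations, an explicit formula does not. The same freedom permits the correction on letters. The
    strict inequality gamma (n + 1) < 1 comes from gamma^-1 not being an integer; with theta = gamma
    (n + 1), it enters through the constant 1 / (2^(1 - theta) - 1) of the dyadic construction,
    which blows up at theta = 1. Truncated group elements are functions on all words, and truncation
    is a condition on weights. Logarithms are finite expressions: on a fixed word the convolution
    power y^{*k} is a polynomial in k, and identities between polynomials are checked at natural
    numbers. The behaviour of the logarithm under shuffles is thus read off from that of the
    powers. *)

Section Pairing.
Context (R : comNzRingType) (K : choiceType).
Implicit Types (x y : {malg R[K]}) (phi psi : K -> R).

(** Linear forms are given by their values on a basis, so that identities between tensors become
    exchanges of finite sums, as in [ev_swap]. *)
Definition ev x phi : R := linext (phi : K -> R^o) x.

Lemma evE x phi : ev x phi = \sum_(k <- msupp x) x@_k * phi k.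
Proof. by rewrite /ev linextE. Qed.

Lemma evU k phi : ev << k >> phi = phi k.
Proof. by rewrite /ev linextU1. Qed.

Lemma evD x y phi : ev (x + y) phi = ev x phi + ev y phi.
Proof. by rewrite /ev linearD. Qed.

Lemma evB x y phi : ev (x - y) phi = ev x phi - ev y phi.
Proof. by rewrite /ev linearB. Qed.

Lemma evZ (a : R) x phi : ev (a *: x) phi = a * ev x phi.
Proof. by rewrite /ev linearZ. Qed.

Lemma ev_sum I (r : seq I) P (F : I -> {malg R[K]}) phi :
  ev (\sum_(i <- r | P i) F i) phi = \sum_(i <- r | P i) ev (F i) phi.
Proof. by rewrite /ev linear_sum. Qed.

Lemma eq_ev_supp x phi psi : {in msupp x, phi =1 psi} -> ev x phi = ev x psi.
Proof.
by move=> h; rewrite !evE big_seq [RHS]big_seq; apply: eq_bigr => k /h ->.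
Qed.

Lemma eq_ev x phi psi : phi =1 psi -> ev x phi = ev x psi.
Proof. by move=> h; apply: eq_ev_supp => k _. Qed.

Lemma ev_addr x phi psi : ev x (fun k => phi k + psi k) = ev x phi + ev x psi.
Proof. by rewrite !evE -big_split; apply: eq_bigr => k _; rewrite mulrDr. Qed.

Lemma ev_mulrl x a phi : ev x (fun k => a * phi k) = a * ev x phi.
Proof. by rewrite !evE mulr_sumr; apply: eq_bigr => k _; rewrite mulrCA. Qed.

Lemma ev_mulrr x a phi : ev x (fun k => phi k * a) = ev x phi * a.
Proof. by rewrite mulrC -ev_mulrl; apply: eq_ev => k; rewrite mulrC. Qed.

Lemma ev_oppr x phi : ev x (fun k => - phi k) = - ev x phi.
Proof. by rewrite -mulN1r -ev_mulrl; apply: eq_ev => k; rewrite mulN1r. Qed.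

Lemma ev_subr x phi psi : ev x (fun k => phi k - psi k) = ev x phi - ev x psi.
Proof. by rewrite ev_addr ev_oppr. Qed.

Lemma ev_eq0 x phi : phi =1 (fun=> 0) -> ev x phi = 0.
Proof. by move=> h; rewrite evE big1 // => k _; rewrite h mulr0. Qed.

Lemma ev_sumr I (r : seq I) x (F : I -> K -> R) :
  ev x (fun k => \sum_(i <- r) F i k) = \sum_(i <- r) ev x (F i).
Proof.
elim: r => [|i r IH]; first by rewrite big_nil ev_eq0 // => k; rewrite big_nil.
by rewrite big_cons -IH -ev_addr; apply: eq_ev => k; rewrite big_cons.
Qed.

End Pairing.

Lemma ev_swap (R : comNzRingType) (K L : choiceType) (x : {malg R[K]})
    (y : {malg R[L]}) (phi : K -> L -> R) :
  ev x (fun k => ev y (phi k)) = ev y (fun l => ev x (phi^~ l)).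
Proof.
rewrite evE (eq_ev _ (fun l => evE x (phi^~ l))) ev_sumr.
by apply: eq_bigr => k _; rewrite ev_mulrl.
Qed.

Lemma ev_linext (R : comNzRingType) (K L : choiceType) (x : {malg R[K]})
    (f : K -> {malg R[L]}) (phi : L -> R) :
  ev (linext f x) phi = ev x (fun k => ev (f k) phi).
Proof. by rewrite linextE ev_sum evE; apply: eq_bigr => k _; rewrite evZ. Qed.

Lemma evM (R : comNzRingType) (K : monomType) (x y : {malg R[K]}) (phi : K -> R) :
  ev (x * y) phi = ev x (fun k => ev y (fun l => phi (mmul k l))).
Proof.
rewrite malgME ev_sum evE; apply: eq_bigr => k _.
rewrite ev_sum evE mulr_sumr; apply: eq_bigr => l _.
by rewrite malgUZ evZ evU mulrA.
Qed.

(** * Shuffle product and deconcatenation, paired with functions on words *)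

Section Words.
Context (R : realType) (A : choiceType).
Implicit Types (a b : A) (u v w : seq A) (phi psi y z : seq A -> R).
Implicit Types (K : seq A -> seq A -> R).

Definition shw phi u v : R := ev (shuffle_seq R u v) (fun w : {fmonom A} => phi w).

Lemma shw_nilr phi u : shw phi u [::] = phi u.
Proof. by rewrite /shw shuffle_seqs0 evU. Qed.

Lemma shw_nill phi v : shw phi [::] v = phi v.
Proof. by rewrite /shw shuffle_seq0s evU. Qed.

Lemma shw_cons phi a u b v : shw phi (a :: u) (b :: v) =
  shw (fun w => phi (a :: w)) u (b :: v) + shw (fun w => phi (b :: w)) (a :: u) v.
Proof.
have e c (x : TA R A) : ev (letter R c * x) (fun w : {fmonom A} => phi w) =
    ev x (fun w : {fmonom A} => phi (c :: w)).
  by rewrite evM evU; apply: eq_ev => w; rewrite fmM fmU.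
rewrite /shw shuffle_seq_cons [LHS]evD.
exact: (congr2 +%R (e a _) (e b _)).
Qed.

(** A shuffle of [u] and [v] only permutes the letters of [u ++ v], so truncation by weight is
    compatible with shuffles. *)
Lemma eq_shw phi psi u v :
  (forall w, perm_eq w (u ++ v) -> phi w = psi w) -> shw phi u v = shw psi u v.
Proof.
elim: u v phi psi => [|a u IHu] v phi psi h; first by rewrite !shw_nill h.
elim: v phi psi h => [|b v IHv] phi psi h; first by rewrite !shw_nilr h ?cats0.
rewrite !shw_cons; congr (_ + _).
  by apply: IHu => w pw; apply: h; rewrite /= perm_cons.
apply: IHv => w pw; apply: h.
by rewrite -(permPr (_ : perm_eq (b :: (a :: u) ++ v) _)) ?perm_cons // -cat1s perm_catCA.
Qed.

Lemma shwD phi psi u v : shw (fun w => phi w + psi w) u v = shw phi u v + shw psi u v.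
Proof. exact: ev_addr. Qed.

Lemma shwB phi psi u v : shw (fun w => phi w - psi w) u v = shw phi u v - shw psi u v.
Proof. exact: ev_subr. Qed.

Lemma shwMl c phi u v : shw (fun w => c * phi w) u v = c * shw phi u v.
Proof. exact: ev_mulrl. Qed.

Lemma shwMr c phi u v : shw (fun w => phi w * c) u v = shw phi u v * c.
Proof. exact: ev_mulrr. Qed.

(* The pairing of K with the deconcatenation coproduct of w. *)
Fixpoint deconc K w : R :=
  if w is a :: w' then K [::] w + deconc (fun p => K (a :: p)) w' else K [::] [::].

Lemma deconc_cons K a w :
  deconc K (a :: w) = K [::] (a :: w) + deconc (fun p => K (a :: p)) w.
Proof. by []. Qed.

Lemma deconc_take K w :
  deconc K w = \sum_(i < (size w).+1) K (take i w) (drop i w).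
Proof.
elim: w K => [|a w IH] K; first by rewrite big_ord_recl big_ord0 addr0.
by rewrite deconc_cons big_ord_recl take0 drop0 IH.
Qed.

Lemma eq_deconc K K' w :
  (forall p q, p ++ q = w -> K p q = K' p q) -> deconc K w = deconc K' w.
Proof.
by move=> h; rewrite !deconc_take; apply: eq_bigr => i _; rewrite h ?cat_take_drop.
Qed.

Lemma deconcD K K' w :
  deconc (fun p q => K p q + K' p q) w = deconc K w + deconc K' w.
Proof. by rewrite !deconc_take -big_split. Qed.

Lemma deconcMl c K w : deconc (fun p q => c * K p q) w = c * deconc K w.
Proof. by rewrite !deconc_take mulr_sumr. Qed.

Lemma deconcMr c K w : deconc (fun p q => K p q * c) w = deconc K w * c.
Proof. by rewrite !deconc_take mulr_suml. Qed.

Lemma deconcB K K' w :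
  deconc (fun p q => K p q - K' p q) w = deconc K w - deconc K' w.
Proof. by rewrite !deconc_take sumrB. Qed.

Lemma deconc_sum I (r : seq I) P (F : I -> seq A -> seq A -> R) w :
  deconc (fun p q => \sum_(i <- r | P i) F i p q) w =
  \sum_(i <- r | P i) deconc (F i) w.
Proof. by rewrite deconc_take exchange_big; apply: eq_bigr => i _; rewrite deconc_take. Qed.

Lemma deconc_eq0 K w : (forall p q, p ++ q = w -> K p q = 0) -> deconc K w = 0.
Proof. by move=> h; rewrite deconc_take big1 // => i _; rewrite h ?cat_take_drop. Qed.

Lemma deconc_rcons K a w :
  deconc K (rcons w a) = K (rcons w a) [::] + deconc (fun p q => K p (rcons q a)) w.
Proof.
elim: w K => [|b w IH] K /=; first by rewrite addrC.
by rewrite IH addrCA.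
Qed.

Lemma deconcA (F : seq A -> seq A -> seq A -> R) w :
  deconc (fun p q => deconc (fun r s => F r s q) p) w =
  deconc (fun p q => deconc (fun r s => F p r s) q) w.
Proof.
elim: w F => [|a w IH] F //=.
by rewrite -[in RHS](IH (fun p => F (a :: p))) deconcD addrA.
Qed.

(** The bialgebra axiom of the shuffle algebra. The recursion acts on first letters, hence on left
    parts; the cuts with an empty left part are treated apart. *)
Lemma shw_deconc K u v : shw (deconc K) u v =
  deconc (fun u1 u2 => deconc (fun v1 v2 =>
    shw (fun p => shw (K p) u2 v2) u1 v1) v) u.
Proof.
elim: u v K => [|a u IHu] v K.
  rewrite shw_nill /=; apply: eq_deconc => p q _.
  by rewrite shw_nill shw_nill.
elim: v K => [|b v IHv] K.
  rewrite shw_nilr; apply: eq_deconc => p q _.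
  by rewrite /= shw_nilr shw_nilr.
rewrite shw_cons.
rewrite (_ : shw _ u _ = shw (fun w => K [::] (a :: w)) u (b :: v) +
   shw (deconc (fun p => K (a :: p))) u (b :: v)); last by rewrite -shwD.
rewrite (_ : shw _ (a :: u) v = shw (fun w => K [::] (b :: w)) (a :: u) v +
   shw (deconc (fun p => K (b :: p))) (a :: u) v); last by rewrite -shwD.
rewrite IHu IHv addrACA -shw_cons.
rewrite [RHS]deconc_cons [in RHS]deconc_cons !shw_nill -!addrA; congr (_ + _).
rewrite [in LHS]deconc_cons addrCA; congr (_ + _).
  by apply: eq_deconc => p q _; rewrite !shw_nill.
rewrite -deconcD; apply: eq_deconc => p q _.
rewrite !deconc_cons !shw_nilr -addrA; congr (_ + _).
by rewrite -deconcD; apply: eq_deconc => r s _; rewrite shw_cons.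
Qed.

End Words.

(** * Convolution powers on words *)

Section Convolution.
Context (R : realType) (A : choiceType).
Implicit Types (u v w p q : seq A) (y z : seq A -> R).

Definition wunit w : R := (w == [::])%:R.

Definition wconv y z w := deconc (fun p q => y p * z q) w.

Definition wpow y k := iter k (wconv y) wunit.

Lemma deconc_unitr (F : seq A -> seq A -> R) w :
  deconc (fun p q => F p q * wunit q) w = F w [::].
Proof.
elim: w F => [|a w IH] F /=; first by rewrite mulr1.
by rewrite mulr0 add0r (IH (fun p => F (a :: p))).
Qed.

Lemma deconc_unitl (F : seq A -> seq A -> R) w :
  deconc (fun p q => wunit p * F p q) w = F [::] w.
Proof.
case: w => [|a w] /=; first by rewrite mul1r.
by rewrite mul1r deconc_eq0 ?addr0 // => p q _; rewrite mul0r.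
Qed.

Lemma wconv1r y : wconv y wunit = y.
Proof. by apply/funext => w; rewrite /wconv (deconc_unitr (fun p _ => y p)). Qed.

Lemma wconv1l y : wconv wunit y = y.
Proof. by apply/funext => w; rewrite /wconv (deconc_unitl (fun _ q => y q)). Qed.

Lemma wconvA x y z : wconv (wconv x y) z = wconv x (wconv y z).
Proof.
apply/funext => w; rewrite /wconv.
under eq_deconc do rewrite -deconcMr.
rewrite (deconcA (fun p q r => x p * y q * z r)); apply: eq_deconc => p q _.
by rewrite -deconcMl; apply: eq_deconc => r s _; rewrite mulrA.
Qed.

Lemma wconv0 y z : wconv y z [::] = y [::] * z [::].
Proof. by []. Qed.

Lemma wpowS y k : wpow y k.+1 = wconv y (wpow y k).
Proof. by []. Qed.

Lemma wpowD y k l : wpow y (k + l) = wconv (wpow y k) (wpow y l).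
Proof. by elim: k => [|k IH]; rewrite ?wconv1l // addSn !wpowS IH wconvA. Qed.

Lemma wpow_nil y k : wpow y k [::] = y [::] ^+ k.
Proof. by elim: k => [|k IH] //; rewrite wpowS wconv0 IH exprS. Qed.

Lemma wpow_small y k w : y [::] = 0 -> (size w < k)%N -> wpow y k w = 0.
Proof.
move=> y0; elim: k w => [|k IH] // w hw; rewrite wpowS; apply: deconc_eq0 => p q e.
case: p e => [|a p] e; first by rewrite y0 mul0r.
by rewrite IH ?mulr0 // -ltnS (leq_trans _ hw) // -e /= size_cat ltnS ltnS leq_addl.
Qed.

Lemma shw_wconv y z u v : shw (wconv y z) u v =
  deconc (fun u1 u2 => deconc (fun v1 v2 => shw y u1 v1 * shw z u2 v2) v) u.
Proof.
rewrite /wconv shw_deconc; apply: eq_deconc => u1 u2 _; apply: eq_deconc => v1 v2 _.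
rewrite -shwMr; congr shw; apply/funext => p; exact: shwMl.
Qed.

(** The difference of [y] and the unit vanishes on the empty word, so its j-th power vanishes on
    words with fewer than j letters. The range of j therefore does not depend on [k], which makes
    the sum polynomial in [k]. *)
Lemma wpow_binomial y k M w : y [::] = 1 -> (size w <= M)%N ->
  wpow y k w = \sum_(j < M.+1) 'C(k, j)%:R * wpow (fun w => y w - wunit w) j w.
Proof.
move=> y1; set D := fun w => y w - wunit w; elim: k w => [|k IH] w hw.
  rewrite big_ord_recl mul1r big1 ?addr0 // => j _.
  by rewrite lift0 bin0n mul0r.
have -> : wpow y k.+1 w = wpow y k w + wconv D (wpow y k) w.
  rewrite -[X in X w + _]wconv1l -deconcD; apply: eq_deconc => p q _.
  by rewrite -mulrDl addrC /D subrK.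
have -> : wconv D (wpow y k) w = \sum_(j < M.+1) 'C(k, j)%:R * wpow D j.+1 w.
  transitivity (deconc (fun p q =>
      \sum_(j < M.+1) 'C(k, j)%:R * (D p * wpow D j q)) w).
    apply: eq_deconc => p q e; rewrite IH; last first.
      by rewrite (leq_trans _ hw) // -e size_cat leq_addl.
    by rewrite mulr_sumr; apply: eq_bigr => j _; rewrite mulrCA.
  by rewrite deconc_sum; apply: eq_bigr => j _; rewrite deconcMl.
rewrite (IH _ hw) [X in _ + X]big_ord_recr.
rewrite (@wpow_small _ M.+1) ?ltnS // ?/D ?y1 ?subrr // mulr0 [X in _ + X]addr0.
rewrite [in RHS]big_ord_recl [X in X + _]big_ord_recl !bin0 -addrA.
rewrite -big_split.
by congr (_ + _); apply: eq_bigr => j _; rewrite !lift0 binS natrD mulrDl.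
Qed.

End Convolution.

(** * The logarithm as the linear coefficient of y^{*k} in k *)

Section BinomialPolynomial.
Context (R : realType).

Definition binpoly j : {poly R} := (j`!%:R)^-1 *: \prod_(i < j) ('X - i%:R%:P).

Lemma horner_binpoly j k : (binpoly j).[k%:R] = 'C(k, j)%:R.
Proof.
rewrite hornerZ horner_prod.
have -> : \prod_(i < j) ('X - i%:R%:P).[k%:R] = (k ^_ j)%:R :> R.
  elim: j => [|j IH]; first by rewrite big_ord0.
  rewrite big_ord_recr /= IH hornerXsubC ffactnSr natrM.
  have [jk|kj] := leqP j k; first by rewrite natrB.
  by rewrite ffact_small // !mul0r.
by rewrite -bin_ffact natrM mulrC mulfK // pnatr_eq0 -lt0n fact_gt0.
Qed.

Lemma poly_nat_inj (p q : {poly R}) :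
  (forall k : nat, p.[k%:R] = q.[k%:R]) -> p = q.
Proof.
move=> h; apply/eqP; rewrite -subr_eq0; apply/eqP.
apply: (@roots_geq_poly_eq0 _ _ [seq i%:R | i <- iota 0 (size (p - q)%R)]).
- by apply/allP => _ /mapP[k _ ->]; rewrite rootE hornerD hornerN h subrr.
- by rewrite map_inj_uniq ?iota_uniq //; apply: mulrIn; rewrite oner_eq0.
- by rewrite size_map size_iota.
Qed.

End BinomialPolynomial.

Section Logarithm.
Context (R : realType) (A : choiceType).
Implicit Types (u v w p q : seq A) (y z : seq A -> R).

(* With D = y - 1, the binomial formula makes y^{*k}(w) the polynomial in k    *)
(* sum_j D^{*j}(w) binom(k, j), whose linear coefficient is log y.             *)
Definition wpoly y w : {poly R} :=
  \sum_(j < (size w).+1) wpow (fun w => y w - wunit R w) j w *: binpoly R j.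

Definition wlog y w : R := (wpoly y w)`_1.

Lemma horner_wpoly y k w : y [::] = 1 -> (wpoly y w).[k%:R] = wpow y k w.
Proof.
move=> y1; rewrite (wpow_binomial k y1 (leqnn _)) /wpoly horner_sum.
by apply: eq_bigr => j _; rewrite hornerZ horner_binpoly mulrC.
Qed.

Lemma wlogE y w : wlog y w =
  \sum_(j < (size w).+1) wpow (fun w => y w - wunit R w) j w * (binpoly R j)`_1.
Proof. by rewrite /wlog coef_sum; apply: eq_bigr => j _; rewrite coefZ. Qed.

Lemma wpoly_coef0 y w : y [::] = 1 -> (wpoly y w)`_0 = wunit R w.
Proof. by move=> y1; rewrite -horner_coef0 (horner_wpoly 0). Qed.

Lemma wlog_nil y : y [::] = 1 -> wlog y [::] = 0.
Proof.
move=> y1; rewrite /wlog (_ : wpoly y [::] = 1) ?coef1 //.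
by apply: poly_nat_inj => k; rewrite horner_wpoly // wpow_nil y1 expr1n hornerE.
Qed.

(* The linear terms in l of the two sides of y^{*(l + k)} = y^{*l} * y^{*k}. *)
Lemma deriv_wpoly y w : y [::] = 1 ->
  (wpoly y w)^`() = \sum_(i < (size w).+1) wlog y (take i w) *: wpoly y (drop i w).
Proof.
move=> y1; apply: poly_nat_inj => k.
have e : wpoly y w \Po ('X + k%:R%:P) =
    \sum_(i < (size w).+1) (wpoly y (drop i w)).[k%:R] *: wpoly y (take i w).
  apply: poly_nat_inj => l; rewrite horner_comp !hornerE -natrD horner_wpoly //.
  rewrite wpowD /wconv deconc_take horner_sum; apply: eq_bigr => i _.
  by rewrite hornerZ !horner_wpoly // mulrC.
have := congr1 (fun P : {poly R} => P^`().[0]) e.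
rewrite deriv_comp derivD derivX derivC addr0 mulr1 horner_comp !hornerE => ->.
rewrite (big_morph _ (@derivD R) (@deriv0 R)) !horner_sum; apply: eq_bigr => i _.
rewrite derivZ !hornerZ mulrC; congr (_ * _).
by rewrite /wlog horner_coef0 coef_deriv mulr1n.
Qed.

(** By [deriv_wpoly], coefficient i + 1 is the convolution of the logarithm with coefficient i,
    divided by i + 1. In other words y^{*k} = exp(k log y). *)
Lemma wpoly_coef y i w : y [::] = 1 ->
  (wpoly y w)`_i = (i`!%:R)^-1 * wpow (wlog y) i w.
Proof.
move=> y1; elim: i w => [|i IH] w; first by rewrite wpoly_coef0 // invr1 mul1r.
have e := congr1 (fun P : {poly R} => P`_i) (deriv_wpoly w y1).
rewrite coef_deriv [RHS]coef_sum in e.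
have h : wpow (wlog y) i.+1 w = i`!%:R * ((wpoly y w)`_i.+1 *+ i.+1).
  rewrite e wpowS /wconv deconc_take mulr_sumr; apply: eq_bigr => j _.
  by rewrite coefZ IH mulrCA mulVKf // pnatr_eq0 -lt0n fact_gt0.
rewrite h -[(wpoly _ _)`_ _ *+ _]mulr_natl (mulrA i`!%:R) -natrM mulnC -factS mulKf //.
by rewrite pnatr_eq0 -lt0n fact_gt0.
Qed.

(** The value of the polynomial at k = 1. *)
Lemma wexp_wlog y M w : y [::] = 1 -> (size w <= M)%N ->
  y w = \sum_(i < M.+1) (i`!%:R)^-1 * wpow (wlog y) i w.
Proof.
move=> y1 hw; rewrite -[y in LHS](wconv1r y) -[wconv y _]/(wpow y 1).
rewrite -horner_wpoly // (@horner_coef_wide _ M.+1); last first.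
  apply/leq_sizeP => j hj; rewrite wpoly_coef // wpow_small ?mulr0 ?wlog_nil //.
  exact: leq_ltn_trans hw _.
by apply: eq_bigr => i _; rewrite expr1n mulr1 wpoly_coef.
Qed.

End Logarithm.

(** * Characters up to a given weight and their extension by one weight *)

Section TruncatedCharacters.
Context (R : realType) (A : choiceType) (wt : A -> nat).
Hypothesis wt_gt0 : forall a, (0 < wt a)%N.
Implicit Types (u v w p q : seq A) (y z : seq A -> R) (n : nat).

Definition weight w : nat := \sum_(a <- w) wt a.

Lemma weight_nil : weight [::] = 0%N.
Proof. by rewrite /weight big_nil. Qed.

Lemma weight_cons a w : weight (a :: w) = (wt a + weight w)%N.
Proof. by rewrite /weight big_cons. Qed.

Lemma weight_cat u v : weight (u ++ v) = (weight u + weight v)%N.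
Proof. by rewrite /weight big_cat. Qed.

Lemma weight_rcons w a : weight (rcons w a) = (weight w + wt a)%N.
Proof. by rewrite -cats1 weight_cat weight_cons weight_nil addn0. Qed.

Lemma weight_perm u v : perm_eq u v -> weight u = weight v.
Proof. exact: perm_big. Qed.

Lemma weight_gt0 w : w <> [::] -> (0 < weight w)%N.
Proof. by case: w => // a w _; rewrite weight_cons ltn_addr. Qed.

Lemma size_weight w : (size w <= weight w)%N.
Proof.
elim: w => // a w IH; rewrite weight_cons /= -add1n leq_add //; exact: wt_gt0.
Qed.

Definition agree n y z := forall w, (weight w <= n)%N -> y w = z w.

Lemma agree_wconv n y y' z z' :
  agree n y y' -> agree n z z' -> agree n (wconv y z) (wconv y' z').
Proof.
move=> hy hz w hw; apply: eq_deconc => p q e.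
move: hw; rewrite -e weight_cat => hw.
by rewrite hy ?hz // (leq_trans _ hw) ?leq_addr ?leq_addl.
Qed.

(** A left factor on which [y] and [y'] differ has weight above [n], hence is the whole of [w]: in
    weight n + 1 a perturbation acts additively. *)
Lemma wconv_topl n y y' z w : agree n y y' -> z [::] = 1 -> weight w = n.+1 ->
  wconv y z w - wconv y' z w = y w - y' w.
Proof.
move=> h z1 hw; rewrite /wconv -deconcB.
rewrite -[RHS](deconc_unitr (fun p _ => y p - y' p)); apply: eq_deconc => p q e.
case: q e => [|b q] e; first by rewrite z1 !mulr1.
rewrite mulr0 h ?subrr // -ltnS -hw -e weight_cat -[X in (X < _)%N]addn0 ltn_add2l.
exact: weight_gt0.
Qed.

Lemma wconv_topr n y z z' w : agree n z z' -> y [::] = 1 -> weight w = n.+1 ->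
  wconv y z w - wconv y z' w = z w - z' w.
Proof.
move=> h y1 hw; rewrite /wconv -deconcB.
rewrite -[RHS](deconc_unitl (fun _ q => z q - z' q)); apply: eq_deconc => p q e.
case: p e => [|b p] e; first by rewrite y1 !mul1r.
rewrite mul0r h ?subrr // -ltnS -hw -e weight_cat -[X in (X < _)%N]add0n ltn_add2r.
exact: weight_gt0.
Qed.

Definition shdefect y u v : R := shw y u v - y u * y v.

(* Characters of the shuffle algebra modulo words of weight > n. *)
Definition tchar n y :=
  y [::] = 1 /\ forall u v, (weight u + weight v <= n)%N -> shdefect y u v = 0.

Lemma tcharM n y u v : tchar n y -> (weight u + weight v <= n)%N ->
  shw y u v = y u * y v.
Proof. by move=> [_ h] /h /eqP; rewrite subr_eq0 => /eqP. Qed.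

Lemma eq_shw_agree n y z u v : agree n y z -> (weight u + weight v <= n)%N ->
  shw y u v = shw z u v.
Proof.
move=> h huv; apply: eq_shw => w pw; apply: h.
by rewrite (weight_perm pw) weight_cat.
Qed.

Lemma agree_tchar n y z : agree n y z -> tchar n y -> tchar n z.
Proof.
move=> h [y1 hy]; split=> [|u v huv]; first by rewrite -h ?weight_nil.
have hu : (weight u <= n)%N by rewrite (leq_trans _ huv) ?leq_addr.
have hv : (weight v <= n)%N by rewrite (leq_trans _ huv) ?leq_addl.
rewrite /shdefect -(eq_shw_agree h huv) -(h _ hu) -(h _ hv); exact: hy.
Qed.

Lemma tchar_unit n : tchar n (wunit R (A := A)).
Proof.
split=> // u v _; rewrite /shdefect; case: u v => [|a u] [|b v];
  rewrite ?shw_nill ?shw_nilr ?mul1r ?mulr1 ?subrr //.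
rewrite mul0r subr0 shw_cons.
by rewrite /shw ev_eq0 // ev_eq0 ?addr0.
Qed.

Lemma tchar_wconv n y z : tchar n y -> tchar n z -> tchar n (wconv y z).
Proof.
move=> hy hz; split=> [|u v huv]; first by rewrite wconv0 hy.1 hz.1 mulr1.
apply/eqP; rewrite subr_eq0; apply/eqP; rewrite shw_wconv /wconv -deconcMr.
apply: eq_deconc => u1 u2 eu; rewrite -deconcMl; apply: eq_deconc => v1 v2 ev.
move: huv; rewrite -eu -ev !weight_cat => huv.
have h1 : (weight u1 + weight v1 <= n)%N by clear -huv; lia.
have h2 : (weight u2 + weight v2 <= n)%N by clear -huv; lia.
by rewrite (tcharM hy h1) (tcharM hz h2) mulrACA.
Qed.

(** Cut [u] and [v]. If neither the two left parts nor the two right parts are both empty, each pair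
    has weight at most [n] and multiplicativity applies. Only the two extreme cuts contribute a
    defect, which the units in the auxiliary sum single out. *)
Lemma shdefect_wconv n y z u v : tchar n y -> tchar n z ->
  u <> [::] -> v <> [::] -> (weight u + weight v <= n.+1)%N ->
  shdefect (wconv y z) u v = shdefect y u v + shdefect z u v.
Proof.
move=> hy hz hu hv huv.
transitivity (deconc (fun u1 u2 => deconc (fun v1 v2 =>
  shdefect y u1 v1 * wunit R v2 * wunit R u2 +
  wunit R u1 * (wunit R v1 * shdefect z u2 v2)) v) u); last first.
  transitivity (deconc (fun u1 u2 => shdefect y u1 v * wunit R u2 +
      wunit R u1 * shdefect z u2 v) u).
    apply: eq_deconc => u1 u2 _; rewrite deconcD deconcMr deconcMl.
    rewrite (deconc_unitr (fun p _ => shdefect y u1 p)).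
    by rewrite (deconc_unitl (fun _ q => shdefect z u2 q)).
  rewrite deconcD (deconc_unitr (fun p _ => shdefect y p v)).
  by rewrite (deconc_unitl (fun _ q => shdefect z q v)).
rewrite /shdefect shw_wconv /wconv -deconcMr -deconcB; apply: eq_deconc => u1 u2 eu.
rewrite -deconcMl -deconcB; apply: eq_deconc => v1 v2 ev.
have [e|ne] := eqVneq (u2 ++ v2) [::].
  case: u2 v2 e eu ev => [|//] [|//] _; rewrite !cats0 => -> ->.
  rewrite shw_nill hz.1 !mulr1 (_ : wunit R u = 0) ?mul0r ?addr0 ?mulr1 //.
  by rewrite /wunit; case: eqP hu.
have [e|ne'] := eqVneq (u1 ++ v1) [::].
  case: u1 v1 e eu ev => [|//] [|//] _ /= -> ->.
  rewrite shw_nill hy.1 !mul1r (_ : wunit R u = 0) ?mulr0 ?add0r //.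
  by rewrite /wunit; case: eqP hu.
have /weight_gt0 : u2 ++ v2 <> [::] by apply/eqP.
have /weight_gt0 : u1 ++ v1 <> [::] by apply/eqP.
move: huv; rewrite -eu -ev !weight_cat => huv h1 h2.
have h3 : (weight u1 + weight v1 <= n)%N by clear -huv h1 h2; lia.
have h4 : (weight u2 + weight v2 <= n)%N by clear -huv h1 h2; lia.
rewrite (tcharM hy h3) (tcharM hz h4).
by rewrite !subrr !mulr0 !mul0r addr0 mulrACA subrr.
Qed.

Lemma tchar_wpow n y k : tchar n y -> tchar n (wpow y k).
Proof.
by move=> hy; elim: k => [|k IH]; [exact: tchar_unit | exact: tchar_wconv].
Qed.

Lemma shdefect_wpow n y k u v : tchar n y ->
  u <> [::] -> v <> [::] -> (weight u + weight v <= n.+1)%N ->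
  shdefect (wpow y k) u v = k%:R * shdefect y u v.
Proof.
move=> hy hu hv huv; elim: k => [|k IH].
  by rewrite mul0r; case: (tchar_unit n.+1) => _; apply.
rewrite wpowS (shdefect_wconv hy (tchar_wpow k hy)) // IH.
by rewrite -[X in X + _]mul1r -mulrDl -natr1 addrC.
Qed.

(* All powers y^{*k} of a truncated character are truncated characters, with a *)
(* defect in weight n + 1 that is linear in k; compare the coefficients of k.  *)
Lemma shw_wlog n y u v : tchar n y ->
  u <> [::] -> v <> [::] -> (weight u + weight v <= n.+1)%N ->
  shw (wlog y) u v = shdefect y u v.
Proof.
move=> hy hu hv huv; pose x := shuffle_seq R u v.
pose Q := linext (fun w : {fmonom A} => wpoly y w) x.
have hQ i : Q`_i = shw (fun w => (wpoly y w)`_i) u v.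
  rewrite /Q linextE coef_sum /shw evE; apply: eq_bigr => w _; exact: coefZ.
have hQk k : Q.[k%:R] = shw (wpow y k) u v.
  rewrite /Q linextE horner_sum /shw evE; apply: eq_bigr => w _.
  by rewrite hornerZ horner_wpoly // hy.1.
have : Q - wpoly y u * wpoly y v = shdefect y u v *: 'X.
  apply: poly_nat_inj => k; rewrite !hornerE hQk !horner_wpoly ?hy.1 //.
  by rewrite -[LHS]/(shdefect _ _ _) (shdefect_wpow k hy hu hv huv) mulrC.
move=> /(congr1 (fun P : {poly R} => P`_1)); rewrite coefB coefZ coefX mulr1 hQ => <-.
rewrite coefM !big_ord_recr big_ord0 /= !wpoly_coef0 ?hy.1 //.
rewrite /wunit; case: eqP hu => // _ _; case: eqP hv => // _ _.
by rewrite mul0r mulr0 !addr0 subr0.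
Qed.

(** If y(w) = 0 in weight n + 1, the formula y = exp(log y) reads 0 = log y(w) + S, where S collects
    the powers of order at least 2 and involves the logarithm only in weights at most n. Dropping
    log y(w) leaves S = - log y(w). *)
Definition extend n y w : R := if weight w == n.+1 then - wlog y w else y w.

Lemma agree_extend n y : agree n (extend n y) y.
Proof. by move=> w hw; rewrite /extend; case: eqP => // e; lia. Qed.

(* The value is exp of the part of log y of weight at most n, when y vanishes  *)
(* in weight n + 1.                                                            *)
Lemma tchar_extend n y : tchar n y -> (forall w, (n < weight w)%N -> y w = 0) ->
  tchar n.+1 (extend n y).
Proof.
move=> hy y0; split=> [|u v]; first by rewrite /extend weight_nil hy.1.
rewrite leq_eqVlt ltnS => /orP[/eqP huv|huv]; last first.
  by case: (agree_tchar (fun w hw => esym (agree_extend y hw)) hy) => _; apply.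
have [->|/eqP hu] := eqVneq u [::].
  by rewrite /shdefect shw_nill [X in X * _]/extend weight_nil hy.1 mul1r subrr.
have [->|/eqP hv] := eqVneq v [::].
  by rewrite /shdefect shw_nilr [X in _ * X]/extend weight_nil hy.1 mulr1 subrr.
have := weight_gt0 hu; have := weight_gt0 hv => pv pu.
have hw w : perm_eq w (u ++ v) -> weight w = n.+1.
  by move/weight_perm ->; rewrite weight_cat.
(* [y] is zero on these words. It is inserted because the logarithm takes on the shuffle the value
   of the defect of [y], so that the difference is [y u * y v]. *)
rewrite /shdefect (@eq_shw _ _ _ (fun w => y w - wlog y w)); last first.
  by move=> w /hw e; rewrite /extend e eqxx y0 ?e // sub0r.
have hu' : (weight u <= n)%N by clear -huv pv; lia.
have hv' : (weight v <= n)%N by clear -huv pu; lia.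
rewrite shwB (shw_wlog hy) ?huv // /shdefect (agree_extend y hu') (agree_extend y hv').
by rewrite subKr subrr.
Qed.

End TruncatedCharacters.

(** * Sequences with geometrically small increments *)

Section GeometricLimit.
Import numFieldNormedType.Exports.
Local Open Scope classical_set_scope.
Local Open Scope classical_set_scope.
Context (R : realType) (u : nat -> R) (C q : R).
Hypotheses (C_ge0 : 0 <= C) (q_ge0 : 0 <= q) (q_lt1 : q < 1).
Hypothesis hu : forall k, `|u k.+1 - u k| <= C * q ^+ k.

Lemma geometric_cvg : cvgn u.
Proof.
have h : cvgn (series (telescope u)).
  apply: normed_cvg; apply: (@series_le_cvg _ _ (geometric C q)) => //=.
  - by move=> k; rewrite mulr_ge0 ?exprn_ge0.
  - by apply: is_cvg_geometric_series; rewrite ger0_norm.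
have -> : u = (fun k => series (telescope u) k + u 0%N).
  by apply/funext => k; rewrite telescopeK /= subrK.
apply: is_cvgD => //; exact: is_cvg_cst.
Qed.

Lemma geometric_dist k : `|limn u - u k| <= C / (1 - q) * q ^+ k.
Proof.
have q1 : 0 < 1 - q by rewrite subr_gt0.
have d m : `|u (k + m)%N - u k| <= C / (1 - q) * (q ^+ k - q ^+ (k + m)).
  elim: m => [|m IH]; first by rewrite addn0 !subrr normr0 mulr0.
  rewrite addnS -(subrK (u (k + m)%N) (u _.+1)) -addrA (le_trans (ler_normD _ _)) //.
  apply: le_trans (lerD (hu _) IH) _.
  rewrite le_eqVlt; apply/orP; left; apply/eqP; rewrite exprS.
  by field; rewrite gt_eqF.
have e : limn u = limn (fun m => u (m + k)%N).
  by symmetry; apply/cvg_lim => //; rewrite cvg_shiftn; exact: geometric_cvg.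
have cv : (fun m => `|u (m + k)%N - u k|) @ \oo --> `|limn u - u k|.
  apply: cvg_norm; apply: cvgB; last exact: cvg_cst.
  rewrite (@cvg_shiftn _ _ u); exact: geometric_cvg.
have <- := cvg_lim (@Rhausdorff R) cv.
apply: limr_le; first by apply/cvg_ex; eexists; exact: cv.
near=> m; rewrite addnC; apply: le_trans (d m) _.
by rewrite ler_wpM2l ?divr_ge0 ?(ltW q1) // lerBlDr lerDl exprn_ge0.
Unshelve. all: by end_near. Qed.

End GeometricLimit.

(** * Primitives of small additive cocycles with exponent in ]0, 1[ *)

Section DyadicPrimitive.
Import numFieldNormedType.Exports.
Local Open Scope classical_set_scope.
Context (R : realType).
Implicit Types (c : R -> R -> R -> R) (r s t u : R) (k m j : nat).

Definition dy k m : R := m%:R / 2 ^+ k.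

(* A function on the dyadic points of level k, chosen so that the increments  *)
(* g t - g s - c 0 s t over the two halves of a dyadic interval are equal.    *)
Fixpoint dyadic c k : nat -> R :=
  if k is k'.+1 then fun m =>
    let j := m./2 in
    if odd m then
      dyadic c k' j + c 0 (dy k' j) (dy k m) +
        (dyadic c k' j.+1 - dyadic c k' j - c 0 (dy k' j) (dy k' j.+1)
          - c (dy k' j) (dy k m) (dy k' j.+1)) / 2
    else dyadic c k' j
  else fun=> 0.

Definition dyincr c k m :=
  dyadic c k m.+1 - dyadic c k m - c 0 (dy k m) (dy k m.+1).

Definition dyidx k t := Num.truncn (t * 2 ^+ k).
Definition dyapprox c t k :=
  dyadic c k (dyidx k t) + c 0 (dy k (dyidx k t)) t.

(* If h is a primitive of c, then g t = h 0 t satisfies                        *)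
(* g t = g r + c 0 r t + h r t, and h r t tends to 0 when r = dy k (dyidx k t). *)
Definition dyprim c t : R := limn (dyapprox c t).
(** By the cocycle identity [- c 0 s t] already solves the coboundary equation, but it need not be
    small with [t - s]. Adding the increment of a function preserves the equation and repairs the
    size. *)
Definition primitive c s t : R := dyprim c t - dyprim c s - c 0 s t.

Lemma dyS k j : dy k.+1 j.*2 = dy k j.
Proof.
by rewrite /dy exprS -muln2 natrM; field; rewrite gt_eqF ?exprn_gt0.
Qed.

Lemma pow2_gt0 k : 0 < 2 ^+ k :> R.
Proof. by rewrite exprn_gt0. Qed.

Lemma dyidx_itv k t : 0 <= t -> dy k (dyidx k t) <= t < dy k (dyidx k t).+1.
Proof.
move=> t0; have /truncn_itv : 0 <= t * 2 ^+ k by rewrite mulr_ge0 ?exprn_ge0.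
by rewrite -/(dyidx k t) /dy ler_pdivrMr ?ltr_pdivlMr ?pow2_gt0.
Qed.

Lemma dyidx_dy k m : dyidx k (dy k m) = m.
Proof. by rewrite /dyidx /dy divfK ?gt_eqF ?pow2_gt0 // natrK. Qed.

Lemma dy_lt k i j : (dy k i < dy k j) = (i < j)%N.
Proof. by rewrite /dy ltr_pM2r ?invr_gt0 ?pow2_gt0 // ltr_nat. Qed.

Lemma dyidx_half k t : 0 <= t -> (dyidx k.+1 t)./2 = dyidx k t.
Proof.
move=> t0; have /andP[a1 a2] := dyidx_itv k t0; have /andP[b1 b2] := dyidx_itv k.+1 t0.
have := le_lt_trans a1 b2; have := le_lt_trans b1 a2.
by rewrite -!(dyS k) !dy_lt; lia.
Qed.

Lemma dy1 k : dy k (2 ^ k) = 1.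
Proof. by rewrite /dy natrX divff // gt_eqF ?pow2_gt0. Qed.

Lemma dy_01 k m : (m <= 2 ^ k)%N -> 0 <= dy k m <= 1.
Proof.
move=> h; rewrite divr_ge0 ?exprn_ge0 //=.
by rewrite -(dy1 k) leNgt dy_lt -leqNgt.
Qed.

Lemma dy_next k m : dy k m.+1 = dy k m + 2^-1 ^+ k.
Proof. by rewrite /dy -natr1 mulrDl mul1r exprVn. Qed.

Lemma dyincr_double c k j : dyincr c k.+1 j.*2 =
  (dyincr c k j - c (dy k j) (dy k.+1 j.*2.+1) (dy k j.+1)) / 2.
Proof.
rewrite /dyincr /= odd_double /= uphalf_double doubleK dyS; ring.
Qed.

Definition dyq theta : R := 2^-1 `^ theta.
(** Halving an interval turns a bound a on increments at level k into (a + C q^k) / 2. The bound C K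
    q^k reproduces itself when (K + 1) / 2 = K q; the solution is positive because q > 1/2, that is,
    theta < 1. *)
Definition dyK theta : R := (2 * dyq theta - 1)^-1.

Section Bounds.
Context (c : R -> R -> R -> R) (theta C : R).
Hypotheses (theta_gt0 : 0 < theta) (theta_lt1 : theta < 1).
Local Notation I t := (0 <= t <= 1).
Hypothesis cocycle : forall r s u t, I r -> I s -> I u -> I t ->
  c r s t + c s u t = c r u t + c r s u.
Hypothesis bound : forall s u t, I s -> I u -> I t ->
  `|c s u t| <= C * (`|u - s| + `|t - u|) `^ theta.

Local Notation q := (dyq theta).
Local Notation K := (dyK theta).

Lemma dyq_powR k : (2^-1 ^+ k) `^ theta = q ^+ k.
Proof.
elim: k => [|k IH]; first by rewrite !expr0 powR1.
by rewrite !exprS powRM ?IH ?exprn_ge0 // invr_ge0.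
Qed.

Lemma dyq_gt0 : 0 < q. Proof. by rewrite powR_gt0 // invr_gt0. Qed.

Lemma dyq_lt1 : q < 1.
Proof.
have e : (1 : R) `^ theta = 1 by rewrite powR1.
by rewrite -[X in _ < X]e gt0_ltr_powR ?nnegrE ?invr_ge0 //; lra.
Qed.

Lemma dyq_gt_half : 2^-1 < q.
Proof.
have h : (2^-1 : R) `^ (1 - theta) < 1.
  have e : (1 : R) `^ (1 - theta) = 1 by rewrite powR1.
  by rewrite -[X in _ < X]e gt0_ltr_powR ?nnegrE ?invr_ge0 ?subr_gt0 ?invf_lt1 ?ltr1n.
have e : (2^-1 : R) = 2^-1 `^ (1 - theta) * q.
  by rewrite -powRD ?subrK ?powRr1 ?invr_ge0 // gt_eqF ?invr_gt0 ?implybT.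
by rewrite e gtr_pMl ?dyq_gt0.
Qed.

Lemma dyK_gt0 : 0 < K.
Proof. by rewrite invr_gt0; have := dyq_gt_half; lra. Qed.

Lemma bound_cst_ge0 : 0 <= C.
Proof.
have h : (`|0 - 0 : R| + `|1 - 0|) `^ theta = 1.
  by rewrite !subr0 normr0 normr1 add0r powR1.
have i0 : I (0 : R) by lra. have i1 : I (1 : R) by lra.
have := bound i0 i0 i1; rewrite h mulr1; exact: le_trans.
Qed.

Lemma cocycle_le s u t (e : R) : I s -> I u -> I t -> `|u - s| + `|t - u| <= e ->
  `|c s u t| <= C * e `^ theta.
Proof.
move=> hs hu ht he; apply: le_trans (bound hs hu ht) _.
rewrite ler_wpM2l ?bound_cst_ge0 // ge0_ler_powR ?nnegrE ?(ltW theta_gt0) //.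
  by rewrite addr_ge0.
by apply: le_trans he; rewrite addr_ge0.
Qed.

Lemma cocycle_rrr r : I r -> c r r r = 0.
Proof.
move=> hr; have := bound hr hr hr; rewrite subrr normr0 addr0 powR0 ?gt_eqF //.
by rewrite mulr0 normr_le0 => /eqP.
Qed.

Lemma cocycle_rrt r t : I r -> I t -> c r r t = 0.
Proof.
by move=> hr ht; have := cocycle hr hr hr ht; rewrite cocycle_rrr //; lra.
Qed.

Lemma cocycle_rtt r t : I r -> I t -> c r t t = 0.
Proof.
by move=> hr ht; have := cocycle hr ht ht ht; rewrite cocycle_rrr //; lra.
Qed.

(** The cocycle identity at 0, the left end, the midpoint and the right end shows that what the left
    half leaves over is the same amount again. *)
Lemma dyincr_doubleS k j : (j < 2 ^ k)%N -> dyincr c k.+1 j.*2.+1 =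
  (dyincr c k j - c (dy k j) (dy k.+1 j.*2.+1) (dy k j.+1)) / 2.
Proof.
move=> hj; rewrite {1}/dyincr -doubleS dyS.
have e1 : dyadic c k.+1 j.+1.*2 = dyadic c k j.+1 by rewrite /= odd_double doubleK.
have e2 : dyadic c k.+1 j.*2.+1 = dyadic c k j + c 0 (dy k j) (dy k.+1 j.*2.+1) +
    (dyincr c k j - c (dy k j) (dy k.+1 j.*2.+1) (dy k j.+1)) / 2.
  by rewrite /= odd_double /= uphalf_double.
have i0 : I (0 : R) by rewrite lexx ler01.
have i1 : I (dy k j) by apply/dy_01/ltnW.
have i2 : I (dy k j.+1) by apply: dy_01.
have i3 : I (dy k.+1 j.*2.+1) by apply: dy_01; rewrite expnS; clear -hj; lia.
have := cocycle i0 i1 i3 i2; rewrite e1 e2 /dyincr => h.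
lra.
Qed.

Lemma dyincr_le k m : (m < 2 ^ k)%N -> `|dyincr c k m| <= C * K * q ^+ k.
Proof.
have hK : (K + 1) / 2 = K * q.
  have : 2 * q - 1 != 0 by rewrite gt_eqF // -[X in _ < X]invrK invr_gt0 dyK_gt0.
  by rewrite /dyK => h; field.
elim: k m => [|k IH] m hm.
  have dy0 : dy 0 0 = 0 by rewrite /dy mul0r.
  have i0 : I (0 : R) by rewrite lexx ler01.
  move: hm; rewrite expn0 ltnS leqn0 => /eqP ->; rewrite /dyincr dy0 cocycle_rrt ?dy_01 //.
  by rewrite !subrr normr0 mulr1 mulr_ge0 ?bound_cst_ge0 ?(ltW dyK_gt0).
(* Both halves carry the same increment, so the parity of [m] does not matter. *)
rewrite [X in `|X|](_ : _ =
   (dyincr c k m./2 - c (dy k m./2) (dy k.+1 m./2.*2.+1) (dy k m./2.+1)) / 2); last first.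
  rewrite -{1}(odd_double_half m); case: (odd m); rewrite ?add0n ?add1n.
    by rewrite dyincr_doubleS // -ltn_double -(ltn_add2l (odd m)); move: hm; rewrite expnS; lia.
  by rewrite dyincr_double.
set j := m./2; have hj : (j < 2 ^ k)%N by move: hm; rewrite expnS /j; clear; lia.
have i1 : I (dy k j) by apply/dy_01/ltnW.
have i2 : I (dy k j.+1) by apply: dy_01.
have i3 : I (dy k.+1 j.*2.+1) by apply: dy_01; rewrite expnS; clear -hj; lia.
have hc : `|c (dy k j) (dy k.+1 j.*2.+1) (dy k j.+1)| <= C * q ^+ k.
  rewrite -dyq_powR; apply: cocycle_le => //.
  have := dy_next k j; have := dy_next k.+1 j.*2; have := dy_next k.+1 j.*2.+1.
  rewrite -doubleS !dyS => e1 e2 e3.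
  have p : 0 <= (2^-1 : R) ^+ k.+1 by rewrite exprn_ge0 // invr_ge0.
  by rewrite !ger0_norm; lra.
rewrite normrM (normfV 2) normr_nat exprS.
have := ler_normB (dyincr c k j) (c (dy k j) (dy k.+1 j.*2.+1) (dy k j.+1)).
have := IH _ hj; set a := `|dyincr _ _ _|; set b := `|c _ _ _| in hc *; set z := `|_ - _|.
have -> : C * K * (q * q ^+ k) = (C * K * q ^+ k + C * q ^+ k) / 2.
  by rewrite -mulrA (mulrA K) -hK; field.
by lra.
Qed.

(** The approximation changes only if the dyadic point below [t] moves to a midpoint; the change is
    then one increment of level k + 1 plus one value of the cocycle. *)
Lemma dyapproxS t k : I t ->
  `|dyapprox c t k.+1 - dyapprox c t k| <= C * (1 + K) * q ^+ k.
Proof.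
move=> it; have /andP[t0 t1] := it.
have hm := dyidx_half k t0; have /andP[a1 a2] := dyidx_itv k t0.
have /andP[b1 b2] := dyidx_itv k.+1 t0.
have CK : 0 <= C * (1 + K) * q ^+ k.
  by rewrite !mulr_ge0 ?bound_cst_ge0 ?exprn_ge0 ?(ltW dyq_gt0) // addr_ge0 // ltW ?dyK_gt0.
move: b1 b2; rewrite /dyapprox.
move: hm; move: (dyidx k t) (dyidx k.+1 t) a1 a2 => j m a1 a2 hm b1 b2.
rewrite /=; case: (boolP (odd m)) => om; last first.
  have -> : m = j.*2 by clear -hm om; lia.
  by rewrite dyS doubleK subrr normr0.
have em : m = j.*2.+1 by clear -hm om; lia.
rewrite hm -/(dyincr c k j).
have hj : (j < 2 ^ k)%N.
  have := le_trans b1 t1; rewrite -(dy1 k.+1) leNgt dy_lt -leqNgt expnS; clear -em; lia.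
have i0 : I (0 : R) by rewrite lexx ler01.
have i1 : I (dy k j) by apply/dy_01/ltnW.
have i2 : I (dy k j.+1) by apply: dy_01.
have hm2 : (m < 2 ^ k.+1)%N by rewrite expnS; clear -hj em; lia.
have i3 : I (dy k.+1 m) by apply/dy_01/ltnW.
have e := cocycle i0 i1 i3 it.
rewrite -/(dyincr c k j).
have -> : forall g h, g + c 0 (dy k j) (dy k.+1 m) + h + c 0 (dy k.+1 m) t -
   (g + c 0 (dy k j) t) = h + c (dy k j) (dy k.+1 m) t by move=> g h; lra.
have e2 := dyincr_doubleS hj; rewrite -em in e2; rewrite -e2.
have h1 := @dyincr_le k.+1 m.
have h2 : `|c (dy k j) (dy k.+1 m) t| <= C * q ^+ k.
  rewrite -dyq_powR; apply: cocycle_le => //.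
  have := dy_next k j; have := dy_next k.+1 j.*2; rewrite -em dyS => e3 e4.
  have p : 0 <= (2^-1 : R) ^+ k.+1 by rewrite exprn_ge0 // invr_ge0.
  by rewrite !ger0_norm; lra.
apply: le_trans (ler_normD _ _) _.
have {}h1 : `|dyincr c k.+1 m| <= C * K * q ^+ k.
  apply: le_trans (h1 hm2) _.
  rewrite ler_wpM2l ?mulr_ge0 ?bound_cst_ge0 ?(ltW dyK_gt0) // exprS.
  by rewrite ger_pMl ?exprn_gt0 ?dyq_gt0 // ltW // dyq_lt1.
by lra.
Qed.

Local Notation K' := (C * (1 + K)).
Local Notation D := (K' / (1 - q)).

Lemma approx_cst_ge0 : 0 <= K'.
Proof. by rewrite mulr_ge0 ?bound_cst_ge0 // addr_ge0 // ltW ?dyK_gt0. Qed.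

Lemma dist_cst_ge0 : 0 <= D.
Proof. by rewrite divr_ge0 ?approx_cst_ge0 // subr_ge0 ltW ?dyq_lt1. Qed.

Lemma dyapprox_cvg t : I t -> cvgn (dyapprox c t).
Proof.
move=> it; apply: (geometric_cvg approx_cst_ge0 (ltW dyq_gt0) dyq_lt1) => k.
exact: dyapproxS.
Qed.

Lemma dyprim_dist t k : I t -> `|dyprim c t - dyapprox c t k| <= D * q ^+ k.
Proof.
move=> it; apply: (geometric_dist approx_cst_ge0 (ltW dyq_gt0) dyq_lt1) => l.
exact: dyapproxS.
Qed.

Lemma dyprim_dy k m : (m <= 2 ^ k)%N -> `|dyprim c (dy k m) - dyadic c k m| <= D * q ^+ k.
Proof.
move=> hm; have im := dy_01 hm; have i0 : I (0 : R) by rewrite lexx ler01.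
by have := dyprim_dist k im; rewrite /dyapprox dyidx_dy cocycle_rtt // addr0.
Qed.

Lemma primitive_cocycle s u t : I s -> I u -> I t ->
  primitive c s t = primitive c s u + primitive c u t + c s u t.
Proof.
move=> hs hu ht; have i0 : I (0 : R) by rewrite lexx ler01.
have := cocycle i0 hs hu ht; rewrite /primitive; lra.
Qed.

Lemma primitive_diag t : I t -> primitive c t t = 0.
Proof.
move=> ht; have i0 : I (0 : R) by rewrite lexx ler01.
by rewrite /primitive cocycle_rtt // subrr subr0.
Qed.

Lemma dyscale (e : R) : 0 < e -> e <= 1 ->
  exists k : nat, 2^-1 ^+ k.+1 <= e /\ e <= 2^-1 ^+ k.
Proof.
move=> e0 e1.
have [k hk] : exists k : nat, (2^-1 : R) ^+ k <= e.
  exists (Num.truncn e^-1).+1.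
  have h : e^-1 < 2 ^+ (Num.truncn e^-1).+1.
    have /truncn_itv /andP[_ h] : 0 <= e^-1 by rewrite invr_ge0 ltW.
    by apply: lt_trans h _; rewrite -natrX ltr_nat ltn_expl.
  by rewrite exprVn -[X in _ <= X]invrK lef_pV2 ?posrE ?invr_gt0 ?pow2_gt0 // ltW.
elim: k hk => [|k IH] hk.
  exists 0%N; rewrite expr0; split=> //; rewrite expr1 (le_trans _ hk) //.
  by rewrite expr0 invf_le1 ?ler1n.
have [/IH//|h] := leP (2^-1 ^+ k) e.
by exists k; split => //; apply: ltW.
Qed.

(** The factor 4 comes from two steps of length at most 2 * 2^-k each. *)
Let B : R := C * 4 `^ theta.

Lemma cocycle_cst_ge0 : 0 <= B.
Proof. by rewrite mulr_ge0 ?bound_cst_ge0 ?powR_ge0. Qed.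

Lemma cocycle_le_dy k s u t : I s -> I u -> I t ->
  `|u - s| <= 2 * 2^-1 ^+ k -> `|t - u| <= 2 * 2^-1 ^+ k -> `|c s u t| <= B * q ^+ k.
Proof.
move=> hs hu ht h1 h2.
rewrite -mulrA -dyq_powR -powRM ?exprn_ge0 ?invr_ge0 //; apply: cocycle_le => //.
by lra.
Qed.

Lemma dyprim_tail t k : I t -> `|primitive c (dy k (dyidx k t)) t| <= 2 * D * q ^+ k.
Proof.
move=> it; have /andP[t0 t1] := it; have /andP[a1 a2] := dyidx_itv k t0.
have hj : (dyidx k t <= 2 ^ k)%N.
  by rewrite leqNgt -(dy_lt k) -leNgt dy1 (le_trans a1 t1).
have := dyprim_dist k it; have := dyprim_dy hj.
rewrite /dyapprox /primitive; set x := dyprim c (dy _ _); set y := dyprim c t.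
set g := dyadic _ _ _; set z := c _ _ _; set e := D * _ => h1 h2.
have -> : y - x - z = (y - (g + z)) - (x - g) by lra.
apply: le_trans (ler_normB _ _) _.
by rewrite -mulrA -/e; lra.
Qed.

Lemma primitive_dy k m : (m < 2 ^ k)%N ->
  `|primitive c (dy k m) (dy k m.+1)| <= (C * K + 2 * D) * q ^+ k.
Proof.
move=> hm; have := dyprim_dy hm; have := dyprim_dy (ltnW hm).
have := dyincr_le hm; rewrite /dyincr /primitive.
set x := dyprim c (dy k m); set y := dyprim c (dy k m.+1).
set g := dyadic c k m; set h := dyadic c k m.+1; set z := c _ _ _;
set e := D * _; set f := C * K * _ => h1 h2 h3.
have -> : y - x - z = (h - g - z) + ((y - h) - (x - g)) by lra.
apply: le_trans (ler_normD _ _) _; have := ler_normB (y - h) (x - g).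
by rewrite mulrDl -/f -(mulrA 2) -/e; clearbody f e x y g h z; lra.
Qed.

(** Pass through the dyadic points of level [k] just below [s] and [t], which are equal or adjacent.
    The middle piece costs [C * K + 2 * D], the two tails [2 * D] each, and the three values of the
    cocycle [B] each. *)
Lemma primitive_le_lt k s t : I s -> I t -> s < t -> t - s <= 2^-1 ^+ k ->
  `|primitive c s t| <= (C * K + 6 * D + 3 * B) * q ^+ k.
Proof.
move=> si it st hk.
have /andP[s0 s1] := si; have /andP[t0 t1] := it.
have /andP[a1 a2] := dyidx_itv k s0; have /andP[b1 b2] := dyidx_itv k t0.
set i := dyidx k s in a1 a2 *; set j := dyidx k t in b1 b2 *.
have ij : (i <= j)%N by rewrite -ltnS -(dy_lt k) (le_lt_trans a1) // (lt_trans st).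
have ji : (j <= i.+1)%N.
  rewrite -ltnS -(dy_lt k) (le_lt_trans b1) // dy_next.
  by apply: le_lt_trans (_ : s + 2^-1 ^+ k < _); [lra | rewrite ltrD2r].
have hj : (j <= 2 ^ k)%N by rewrite leqNgt -(dy_lt k) -leNgt dy1 (le_trans b1 t1).
have iI : I (dy k i) by apply/dy_01/(leq_trans ij).
have jI : I (dy k j) by apply/dy_01.
have hmid : `|primitive c (dy k i) (dy k j)| <= (C * K + 2 * D) * q ^+ k.
  have [e|ne] := eqVneq i j.
    rewrite e primitive_diag // normr0 mulr_ge0 ?exprn_ge0 ?(ltW dyq_gt0) //.
    have D0 := dist_cst_ge0; have CK0 := mulr_ge0 bound_cst_ge0 (ltW dyK_gt0); lra.
  have e : j = i.+1 by apply/eqP; rewrite eqn_leq ji ltn_neqAle ne ij.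
  by rewrite e; apply: primitive_dy; rewrite -e.
have hs := dyprim_tail k si; have ht := dyprim_tail k it; rewrite -/i -/j in hs ht.
have p : 0 <= (2^-1 : R) ^+ k by rewrite exprn_ge0 // invr_ge0.
have n1 := dy_next k i; have n2 := dy_next k j.
have c1 : `|c s (dy k i) s| <= B * q ^+ k.
  by apply: cocycle_le_dy => //; rewrite ?(distrC _ s) ger0_norm; lra.
have c2 : `|c s (dy k i) t| <= B * q ^+ k.
  by apply: cocycle_le_dy => //; [rewrite (distrC _ s) | ]; rewrite ger0_norm; lra.
have c3 : `|c (dy k i) (dy k j) t| <= B * q ^+ k.
  have d : dy k i <= dy k j by rewrite leNgt dy_lt -leqNgt.
  by apply: cocycle_le_dy => //; rewrite ger0_norm; lra.
have e1 := primitive_cocycle si iI it.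
(* The tail estimate runs from the dyadic point up to [s]; the loop from [s] to that point and back
   reverses its direction. *)
have e2 := primitive_cocycle si iI si; rewrite primitive_diag // in e2.
have e3 := primitive_cocycle iI jI it.
have -> : primitive c s t = primitive c (dy k i) (dy k j) + primitive c (dy k j) t
   - primitive c (dy k i) s + c s (dy k i) t + c (dy k i) (dy k j) t - c s (dy k i) s.
  by lra.
move: hmid hs ht c1 c2 c3.
set x1 := primitive _ _ _; set x2 := primitive _ _ _; set x3 := primitive _ _ _.
set x4 := c _ _ _; set x5 := c _ _ _; set x6 := c _ _ _.
rewrite !mulrDl -!(mulrA _ D) -!(mulrA _ B).
move: (C * K * q ^+ k) (D * q ^+ k) (B * q ^+ k) => E F G.
clear; clearbody x1 x2 x3 x4 x5 x6; rewrite !ler_norml.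
move=> /andP[? ?] /andP[? ?] /andP[? ?] /andP[? ?] /andP[? ?] /andP[? ?].
by apply/andP; split; lra.
Qed.

Lemma primitive_le : exists C', 0 <= C' /\ forall s t, I s -> I t ->
  `|primitive c s t| <= C' * `|t - s| `^ theta.
Proof.
set M := C * K + 6 * D + 3 * B.
have M0 : 0 <= M.
  have := dist_cst_ge0; have := cocycle_cst_ge0.
  by have := mulr_ge0 bound_cst_ge0 (ltW dyK_gt0); rewrite /M; lra.
have hlt s t : I s -> I t -> s < t -> `|primitive c s t| <= M / q * `|t - s| `^ theta.
  move=> si it st.
  have [||k [k1 k2]] := @dyscale (t - s); first by rewrite subr_gt0.
    by move: si it => /andP[? ?] /andP[? ?]; lra.
  apply: le_trans (primitive_le_lt si it st k2) _.
  rewrite -/M -mulrA ler_wpM2l // ler_pdivlMl ?dyq_gt0 // -exprS -dyq_powR.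
  rewrite ger0_norm ?subr_ge0 ?(ltW st) // ge0_ler_powR ?nnegrE ?(ltW theta_gt0) //.
    by rewrite exprn_ge0 // invr_ge0.
  by rewrite subr_ge0 ltW.
clearbody M; have Mq : 0 <= M / q by rewrite divr_ge0 // ltW ?dyq_gt0.
(* The division by [q] pays for rounding the length up to a power of 1/2. The second term bounds the
   loop value [c s t s], which reverses an interval with t < s. *)
exists (M / q + C * 2 `^ theta).
have C2 : 0 <= C * 2 `^ theta by rewrite mulr_ge0 ?bound_cst_ge0 ?powR_ge0.
split=> [|s t si it]; first by rewrite addr_ge0.
have p0 : 0 <= `|t - s| `^ theta by rewrite powR_ge0.
rewrite [X in _ <= X]mulrDl; have p1 := mulr_ge0 C2 p0; have p2 := mulr_ge0 Mq p0.
case: (ltgtP s t) => [st|ts|e].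
- by apply: le_trans (hlt _ _ si it st) _; rewrite lerDl.
- have h1 := hlt _ _ it si ts; rewrite (distrC s t) in h1.
  have := @cocycle_le s t s (2 * `|t - s|) si it si.
  rewrite (distrC s t) -mulr2n mulr_natl lexx => /(_ isT).
  rewrite -mulr_natl powRM // mulrA => h2.
  have := primitive_cocycle si it si; rewrite primitive_diag // => e.
  have -> : primitive c s t = - (primitive c t s + c s t s) by lra.
  rewrite normrN; apply: le_trans (ler_normD _ _) _; exact: lerD.
by rewrite (_ : primitive c s t = 0) ?normr0 ?addr_ge0 // e primitive_diag.
Qed.

End Bounds.

End DyadicPrimitive.

(** * Linear relations between cocycles pass to their primitives *)

Section PrimitivePairing.
Import numFieldNormedType.Exports.
Local Open Scope classical_set_scope.
Context (R : realType).
Implicit Types (c : R -> R -> R -> R) (r s t : R) (k m : nat).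

Lemma dyadic_eq0 c k m :
  (forall r s t, 0 <= r <= 1 -> 0 <= s <= 1 -> 0 <= t <= 1 -> c r s t = 0) ->
  (m <= 2 ^ k)%N -> dyadic c k m = 0.
Proof.
move=> c0; elim: k m => [|k IH] m hm //=; rewrite expnS in hm.
have i0 : 0 <= (0 : R) <= 1 by rewrite lexx ler01.
have h1 : (m./2 <= 2 ^ k)%N by clear -hm; lia.
case: (boolP (odd m)) => om; last exact: IH.
have h2 : (m./2 < 2 ^ k)%N by clear -hm om; lia.
have h3 : (m <= 2 ^ k.+1)%N by rewrite expnS.
by rewrite !IH // !c0 ?dy_01 // !subr0 mul0r !addr0.
Qed.

Lemma dyadic_ev (L : choiceType) (x : {malg R[L]}) (c : L -> R -> R -> R -> R) k m :
  ev x (fun w => dyadic (c w) k m) = dyadic (fun r s t => ev x (fun w => c w r s t)) k m.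
Proof.
elim: k m => [|k IH] m; first by rewrite ev_eq0.
by rewrite /=; case: (odd m); rewrite -!IH // !(ev_addr, ev_mulrr, ev_oppr).
Qed.

(** A finite combination commutes with the dyadic recursion and with the convergent limits. For [x]
    the shuffle of two words this is the shuffle relation for the primitives. *)
Lemma primitive_ev_eq0 (L : choiceType) (x : {malg R[L]}) (c : L -> R -> R -> R -> R) :
  (forall w t, 0 <= t <= 1 -> cvgn (dyapprox (c w) t)) ->
  (forall r s t, 0 <= r <= 1 -> 0 <= s <= 1 -> 0 <= t <= 1 ->
    ev x (fun w => c w r s t) = 0) ->
  forall s t, 0 <= s <= 1 -> 0 <= t <= 1 ->
    ev x (fun w => primitive (c w) s t) = 0.
Proof.
move=> cv c0 s t si ti; have i0 : 0 <= (0 : R) <= 1 by rewrite lexx ler01.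
have F0 r : 0 <= r <= 1 -> ev x (fun w => dyprim (c w) r) = 0.
  move=> ri; have a0 k : ev x (fun w => dyapprox (c w) r k) = 0.
    have /andP[r0 r1] := ri; have /andP[a1 _] := dyidx_itv k r0.
    have hj : (dyidx k r <= 2 ^ k)%N.
      by rewrite leqNgt -(dy_lt R k) -leNgt dy1 (le_trans a1 r1).
    by rewrite ev_addr dyadic_ev (dyadic_eq0 c0 hj) add0r c0 ?dy_01.
  have lims : (fun k => ev x (fun w => dyapprox (c w) r k)) @ \oo -->
      ev x (fun w => dyprim (c w) r).
    rewrite evE (_ : (fun k => _) = (fun k => \sum_(w <- msupp x) x@_w * dyapprox (c w) r k));
      last by apply/funext => k; rewrite evE.
    apply: cvg_big => [|w _]; first exact: add_continuous.
    by apply: cvgMl_tmp; exact: cv.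
  move: lims; rewrite (_ : (fun k => _) = (fun k => 0)); last exact/funext.
  by move=> h; apply: (cvg_unique (@Rhausdorff R) h); exact: cvg_cst.
by rewrite /primitive !ev_subr !F0 // c0 // !subr0.
Qed.

End PrimitivePairing.

(** * Coassociativity and counit of the coproduct on forests *)

Section CoproductPairing.
Context (R : realType) (d : nat).
Implicit Types (t : tree d) (f g : forest d) (i : 'I_d).
Implicit Types (phi : forest d * forest d -> R).

Lemma fnodes_eq0 f : fnodes f = 0%N -> f = mone.
Proof.
move=> f0; apply: ftreesI; rewrite ftrees1; move: f0; rewrite /fnodes.
by case: (ftrees f) => // t l; rewrite big_cons; have := tnodes_gt0 t; lia.
Qed.

(** In the grafting case the hypothesis covers all forests no larger than [f], because it is applied
    to the left factors in the coproduct of [f]. *)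
Lemma forest_ind (P : forest d -> Prop) :
  P mone -> (forall f g, P f -> P g -> P (mmul f g)) ->
  (forall i f, (forall g, (fnodes g <= fnodes f)%N -> P g) -> P (ucm (graft i f))) ->
  forall f, P f.
Proof.
move=> P1 PM PG f; elim: {f}(fnodes f) {-2}f (leqnn (fnodes f)) => [|n IH] f.
  by rewrite leqn0 => /eqP /fnodes_eq0 ->.
move=> h; have -> : f = \big[mmul/mone]_(t <- ftrees f) ucm t.
  by apply: ftreesI; rewrite (permPr (ftrees_prod _)).
rewrite big_seq; elim/big_ind: _ => // t /tnodes_in ht.
rewrite -(graft_label_branches t); apply: PG => g hg; apply: IH.
apply: leq_trans hg _; rewrite -ltnS -(tnodes_graft (label t)) graft_label_branches.
exact: leq_trans ht h.
Qed.

Definition cev f phi : R := ev (fcoprod R f) phi.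

Lemma fcoprod1 : fcoprod R (@mone (forest d)) = 1.
Proof. by rewrite /fcoprod ftrees1 big_nil. Qed.

Lemma cev1 phi : cev mone phi = phi (mone, mone).
Proof. by rewrite /cev fcoprod1 evU. Qed.

Lemma cevM f g phi :
  cev (mmul f g) phi = cev f (fun p => cev g (fun q => phi (mmul p q))).
Proof. by rewrite /cev fcoprodM evM. Qed.

Lemma cev_graft i f phi : cev (ucm (graft i f)) phi =
  phi (ucm (graft i f), mone) + cev f (fun p => phi (p.1, ucm (graft i p.2))).
Proof.
rewrite /cev -coprodU coprod_graft coprodU evD evU /graft_right ev_linext.
by congr (_ + _); apply: eq_ev => p; rewrite evU.
Qed.

Lemma eq_cev f phi phi' : phi =1 phi' -> cev f phi = cev f phi'.
Proof. exact: eq_ev. Qed.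

Lemma cev_graded f : graded2 (fnodes f) (fcoprod R f).
Proof.
by apply: prod_graded => t _; rewrite /tnodes; apply: pcoprod_graded.
Qed.

Lemma eq_cev_graded f phi phi' :
  (forall p q, (fnodes p + fnodes q)%N = fnodes f -> phi (p, q) = phi' (p, q)) ->
  cev f phi = cev f phi'.
Proof. by move=> h; apply: eq_ev_supp => -[p q] /cev_graded; apply: h. Qed.

(** Both sides are multiplicative in [f]. For a grafted tree, the recursion defining the coproduct
    isolates equal terms with trivial right factor and reduces the rest to [f]. *)
Lemma cevA f (F : forest d -> forest d -> forest d -> R) :
  cev f (fun p => cev p.1 (fun q => F q.1 q.2 p.2)) =
  cev f (fun p => cev p.2 (fun q => F p.1 q.1 q.2)).
Proof.
elim/forest_ind: f F => [|f g IHf IHg|i f IH] F.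
- by rewrite !cev1 /= ?cev1.
- rewrite !cevM.
  transitivity (cev f (fun p => cev p.1 (fun q => cev g (fun p' => cev p'.1 (fun q' =>
      F (mmul q.1 q'.1) (mmul q.2 q'.2) (mmul p.2 p'.2)))))).
    apply: eq_cev => p; rewrite [RHS]ev_swap; apply: eq_cev => p'.
    by rewrite cevM; apply: eq_cev.
  rewrite (IHf (fun a b c => cev g (fun p' => cev p'.1 (fun q' =>
      F (mmul a q'.1) (mmul b q'.2) (mmul c p'.2))))).
  apply: eq_cev => p; rewrite [RHS](_ : _ = cev p.2 (fun q => cev g (fun p' => cev p'.2 (fun q' =>
      F (mmul p.1 p'.1) (mmul q.1 q'.1) (mmul q.2 q'.2))))).
    by apply: eq_cev => q; rewrite (IHg (fun a b c => F (mmul p.1 a) (mmul q.1 b) (mmul q.2 c))).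
  rewrite [RHS]ev_swap; apply: eq_cev => p'.
  by rewrite cevM; apply: eq_cev.
rewrite !cev_graft /= cev1 -addrA; congr (_ + _).
under [in RHS]eq_cev do rewrite cev_graft.
by rewrite [in RHS]/cev ev_addr (IH f (leqnn _) (fun a b c => F a b (ucm (graft i c)))).
Qed.

Lemma cev_counitl f (h : forest d -> R) :
  cev f (fun p => (p.1 == mone)%:R * h p.2) = h f.
Proof.
elim/forest_ind: f h => [|f g IHf IHg|i f IH] h.
- by rewrite cev1 eqxx mul1r.
- rewrite cevM -(IHf (fun a => h (mmul a g))); apply: eq_cev => p.
  rewrite -(IHg (fun a => h (mmul p.2 a))) /cev -ev_mulrl; apply: eq_ev => q.
  rewrite /= mulrA; congr (_ * _); rewrite -natrM mulnb; congr (nat_of_bool _)%:R.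
  by apply/eqP/andP => [/unitm[-> ->]|[/eqP -> /eqP ->]]; rewrite ?eqxx ?mul1m.
rewrite cev_graft /= (IH f (leqnn _) (fun a => h (ucm (graft i a)))).
rewrite (_ : _ == _ = false) ?mul0r ?add0r //; apply/eqP => e.
by have := tnodes_gt0 (graft i f); rewrite -fnodesU e fnodes1.
Qed.

Lemma cev_counitr f (h : forest d -> R) :
  cev f (fun p => h p.1 * (p.2 == mone)%:R) = h f.
Proof.
elim/forest_ind: f h => [|f g IHf IHg|i f _] h.
- by rewrite cev1 eqxx mulr1.
- rewrite cevM -(IHf (fun b => h (mmul b g))); apply: eq_cev => p.
  rewrite -(IHg (fun b => h (mmul p.1 b))) /cev -ev_mulrr; apply: eq_ev => q.
  rewrite /= -mulrA; congr (_ * _); rewrite -natrM mulnb; congr (nat_of_bool _)%:R.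
  rewrite andbC.
  by apply/eqP/andP => [/unitm[-> ->]|[/eqP -> /eqP ->]]; rewrite ?eqxx ?mul1m.
rewrite cev_graft /= eqxx mulr1 [X in _ + X]/cev ev_eq0 ?addr0 // => p.
rewrite (_ : _ == _ = false) ?mulr0 //; apply/eqP => e.
by have := tnodes_gt0 (graft i p.2); rewrite -fnodesU e fnodes1.
Qed.

End CoproductPairing.

(** * The Hairer-Kelly map as a morphism of coalgebras *)

Section HairerKellyPairing.
Context (R : realType) (d : nat).
Implicit Types (t : tree d) (f g : forest d) (i : 'I_d).
Local Notation word := (seq (tree d)).
Implicit Types (phi : word -> R) (u v w : word).

Definition hkev f phi : R := ev (hk_forest R f) (fun w : {fmonom tree d} => phi w).

Lemma eq_hkev f phi phi' : phi =1 phi' -> hkev f phi = hkev f phi'.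
Proof. by move=> h; apply: eq_ev => w; apply: h. Qed.

Lemma hkev1 phi : hkev mone phi = phi [::].
Proof. by rewrite /hkev /hk_forest ftrees1 big_nil one_word evU. Qed.

Lemma hkevM f g phi :
  hkev (mmul f g) phi = hkev f (fun u => hkev g (fun v => shw phi u v)).
Proof.
rewrite /hkev hk_forestM shuffle_def ev_linext; apply: eq_ev => u.
by rewrite ev_linext.
Qed.

(** A closed form of the recursion: the isolated letter of psi(tau) is exactly the contribution of
    the term 1 (x) tau that the reduced coproduct leaves out. *)
Lemma hkev_graft i f phi : hkev (ucm (graft i f)) phi =
  cev f (fun p => hkev p.1 (fun w => phi (rcons w (graft i p.2)))).
Proof.
set t := graft i f; pose th := fun w : {fmonom tree d} => phi w.
have e : red_coprod R t = graft_right i (fcoprod R f) - << (mone, ucm t) >>.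
  by rewrite /red_coprod coprod_graft coprodU [X in X - _ - _]addrC addrK.
pose G (p : forest d * forest d) := ev (hairer_kelly << p.1 >> * tree_letter R p.2) th.
have G_tree p (u : tree d) : G (p, ucm u) = hkev p (fun w => phi (rcons w u)).
  rewrite /G /tree_letter ftreesU [LHS]evM /hkev -hairer_kellyU; apply: eq_ev => w.
  by rewrite evU /th fmM fmU cats1.
have -> : hkev (ucm t) phi = phi [:: t] + ev (red_coprod R t) G.
  rewrite /hkev -hairer_kellyU hairer_kelly_tree [LHS]evD; congr (_ + _).
    by rewrite /letter [LHS]evU fmU.
  exact: ev_linext.
rewrite e [X in _ + X]evB [ev << _ >> _]evU G_tree hkev1 addrC subrK.
rewrite /graft_right [LHS]ev_linext; apply: eq_ev => p.
by rewrite [LHS]evU G_tree.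
Qed.

Local Notation weight := (weight (@tnodes d)).

Lemma eq_hkev_graded f phi phi' :
  (forall w, weight w = fnodes f -> phi w = phi' w) -> hkev f phi = hkev f phi'.
Proof.
elim/forest_ind: f phi phi' => [|f g IHf IHg|i f IH] phi phi' h.
- by rewrite !hkev1 h // weight_nil fnodes1.
- rewrite !hkevM; apply: IHf => u hu; apply: IHg => v hv.
  by apply: eq_shw => w /weight_perm pw; rewrite h // pw weight_cat hu hv fnodesM.
rewrite !hkev_graft; apply: eq_cev_graded => p q e.
apply: IH => [|w hw]; first by rewrite -e leq_addr.
by rewrite h // weight_rcons hw tnodes_graft fnodesU tnodes_graft -e addnS.
Qed.

Lemma hk_forest_supp f (w : word) :
  (hk_forest R f)@_(FMonom w) != 0 -> weight w = fnodes f.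
Proof.
apply: contra_neq_eq => ne.
have : hkev f (fun u => (u == w)%:R) = hkev f (fun=> 0).
  by apply: eq_hkev_graded => u hu; case: eqP => // e; rewrite -hu e eqxx in ne.
rewrite [RHS](ev_eq0 _ (phi := fun=> 0)) // => <-.
rewrite /hkev evE {1}(monalgE (hk_forest R f)) raddf_sum; apply: eq_bigr => u _.
by rewrite [LHS]mcoeffU mulr_natr fmP.
Qed.

Lemma hkev_wunit f : hkev f (wunit R (A := tree d)) = (f == mone)%:R.
Proof.
have [->|ne] := eqVneq f mone; first by rewrite hkev1.
transitivity (hkev f (fun=> 0)); last by rewrite /hkev ev_eq0.
apply: eq_hkev_graded => -[|//] hw; case/eqP: ne; apply: fnodes_eq0.
by rewrite -hw weight_nil.
Qed.

(* The only one-letter word of psi(t) is t. *)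
Lemma hkev_letter t (k : tree d -> R) :
  hkev (ucm t) (fun w => if w is [:: a] then k a else 0) = k t.
Proof.
rewrite -{1}(graft_label_branches t) hkev_graft.
rewrite -[in RHS](graft_label_branches t).
rewrite -[RHS](cev_counitl (branches t) (fun f => k (graft (label t) f))).
apply: eq_cev => p; rewrite -hkev_wunit /hkev -ev_mulrr; apply: eq_ev => w.
by rewrite /wunit; case: (w : word) => [|a [|b v]] /=; rewrite ?mul1r ?mul0r.
Qed.

Lemma shw_hkev f (F : word -> word -> R) u v :
  shw (fun x => hkev f (F x)) u v = hkev f (fun y => shw (F^~ y) u v).
Proof. exact: ev_swap. Qed.

(* The Hairer-Kelly map is a morphism of coalgebras. *)
Lemma hkev_deconc f (K : word -> word -> R) :
  hkev f (deconc K) = cev f (fun p => hkev p.1 (fun u => hkev p.2 (K u))).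
Proof.
elim/forest_ind: f K => [|f g IHf IHg|i f IH] K.
- by rewrite cev1 !hkev1.
- rewrite hkevM cevM.
  transitivity (hkev f (deconc (fun u1 u2 => hkev g (deconc (fun v1 v2 =>
      shw (fun p => shw (K p) u2 v2) u1 v1))))).
    apply: eq_hkev => u; rewrite deconc_take /hkev -ev_sumr; apply: eq_ev => v.
    by rewrite shw_deconc deconc_take.
  rewrite IHf; apply: eq_cev => p.
  transitivity (hkev p.1 (fun u1 => hkev p.2 (fun u2 => cev g (fun q =>
      hkev q.1 (fun v1 => hkev q.2 (fun v2 => shw (fun p => shw (K p) u2 v2) u1 v1)))))).
    by apply: eq_hkev => u1; apply: eq_hkev => u2; rewrite IHg.
  transitivity (cev g (fun q => hkev p.1 (fun u1 => hkev p.2 (fun u2 =>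
      hkev q.1 (fun v1 => hkev q.2 (fun v2 => shw (fun p => shw (K p) u2 v2) u1 v1)))))).
    rewrite [RHS]ev_swap; apply: eq_ev => u1; rewrite [RHS]ev_swap //.
  apply: eq_cev => q; rewrite hkevM; apply: eq_hkev => u1.
  transitivity (hkev q.1 (fun v1 => hkev p.2 (fun u2 => hkev q.2 (fun v2 =>
      shw (fun p => shw (K p) u2 v2) u1 v1)))); first by rewrite [RHS]ev_swap.
  apply: eq_hkev => v1; symmetry.
  rewrite (_ : (fun x => _) = (fun x => hkev p.2 (fun u2 => hkev q.2 (fun v2 =>
      shw (K x) u2 v2)))); last by apply/funext => x; rewrite hkevM.
  by rewrite shw_hkev; apply: eq_hkev => u2; rewrite shw_hkev.
(* Cutting after the last letter gives back psi of the whole tree. Every other cut keeps the root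
   letter on the right, and coassociativity regroups the right parts into psi of a tree. *)
rewrite hkev_graft.
transitivity (cev f (fun p => hkev p.1 (fun w => K (rcons w (graft i p.2)) [::]) +
   hkev p.1 (deconc (fun u v => K u (rcons v (graft i p.2)))))).
  by apply: eq_cev => p; rewrite -[RHS]ev_addr; apply: eq_ev => w; rewrite deconc_rcons.
rewrite [LHS]ev_addr -/(cev _ _) -(hkev_graft i f (fun w => K w [::])) cev_graft /=.
congr (_ + _); first by apply: eq_hkev => u; rewrite hkev1.
transitivity (cev f (fun p => cev p.1 (fun q => hkev q.1 (fun u => hkev q.2 (fun v =>
    K u (rcons v (graft i p.2))))))).
  by apply: eq_cev_graded => p q e; apply: IH; rewrite -e leq_addr.
rewrite (cevA f (fun a b c => hkev a (fun u => hkev b (fun v => K u (rcons v (graft i c)))))).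
apply: eq_cev => p; rewrite [LHS]ev_swap; apply: eq_ev => u.
by rewrite hkev_graft.
Qed.

End HairerKellyPairing.

(** * Calculus of bounds homogeneous in the weight *)

Section HomogeneousBounds.
Context (R : realType) (gamma : R) (gamma_gt0 : 0 < gamma).
Context (T : Type) (D : T -> Prop) (m : T -> R).
Implicit Types (f g : T -> R) (k l : nat).

(** The domain is abstract in order to serve both pairs, with m = |t - s|, and triples, with m = |u
    - s| + |t - u|. *)
Definition bounded k f := exists2 C, 0 <= C &
  forall x, D x -> `|f x| <= C * m x `^ (gamma * k%:R).

Lemma powR_gammaD (a : R) k l :
  a `^ (gamma * (k + l)%:R) = a `^ (gamma * k%:R) * a `^ (gamma * l%:R).
Proof.
have [kl|ne] := eqVneq (k + l)%N 0%N.
  have -> : k = 0%N by lia.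
  have -> : l = 0%N by lia.
  by rewrite addn0 mulr0 !powRr0 mulr1.
rewrite natrD mulrDr powRD //; apply/implyP; rewrite -mulrDr -natrD mulf_eq0.
by rewrite gt_eqF //= pnatr_eq0 (negPf ne).
Qed.

Lemma bounded0 k : bounded k (fun=> 0).
Proof. by exists 0 => // x _; rewrite normr0 mul0r. Qed.

Lemma bounded_cst (a : R) : bounded 0 (fun=> a).
Proof. by exists `|a| => // x _; rewrite mulr0 powRr0 mulr1. Qed.

Lemma eq_bounded k f g : (forall x, D x -> f x = g x) -> bounded k f -> bounded k g.
Proof. by move=> e [C C0 h]; exists C => // x Dx; rewrite -e ?h. Qed.

Lemma boundedD k f g : bounded k f -> bounded k g -> bounded k (fun x => f x + g x).
Proof.
move=> [C C0 hf] [C' C'0 hg]; exists (C + C'); first exact: addr_ge0.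
by move=> x Dx; rewrite mulrDl (le_trans (ler_normD _ _)) // lerD ?hf ?hg.
Qed.

Lemma boundedN k f : bounded k f -> bounded k (fun x => - f x).
Proof. by move=> [C C0 h]; exists C => // x Dx; rewrite normrN h. Qed.

Lemma boundedB k f g : bounded k f -> bounded k g -> bounded k (fun x => f x - g x).
Proof. by move=> hf hg; apply: boundedD => //; apply: boundedN. Qed.

Lemma boundedM k l f g :
  bounded k f -> bounded l g -> bounded (k + l) (fun x => f x * g x).
Proof.
move=> [C C0 hf] [C' C'0 hg]; exists (C * C'); first exact: mulr_ge0.
by move=> x Dx; rewrite powR_gammaD normrM mulrACA ler_pM ?hf ?hg.
Qed.

Lemma boundedMr k f a : bounded k f -> bounded k (fun x => f x * a).
Proof. by move=> h; rewrite -[k]addn0; apply: boundedM => //; apply: bounded_cst. Qed.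

Lemma bounded_sum J (r : seq J) k (F : J -> T -> R) :
  (forall j, bounded k (F j)) -> bounded k (fun x => \sum_(j <- r) F j x).
Proof.
move=> h; elim: r => [|j r IH].
  by apply: eq_bounded (bounded0 k) => x _; rewrite big_nil.
by apply: eq_bounded (boundedD (h j) IH) => x _; rewrite big_cons.
Qed.

Section BoundedFunctionals.
Context (A : choiceType) (wt : A -> nat) (wt_gt0 : forall a, (0 < wt a)%N).
Local Notation weight := (weight wt).
Implicit Types (w p q : seq A) (y z : T -> seq A -> R).

Definition wbounded y := forall w, bounded (weight w) (fun x => y x w).

Lemma wbounded_wconv y z : wbounded y -> wbounded z ->
  wbounded (fun x => wconv (y x) (z x)).
Proof.
move=> hy hz w; rewrite /wconv.
apply: (@eq_bounded _ (fun x => \sum_(i < (size w).+1) y x (take i w) * z x (drop i w))).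
  by move=> x _; rewrite deconc_take.
apply: bounded_sum => i; rewrite -[in weight w](cat_take_drop i w) weight_cat.
exact: boundedM.
Qed.

Lemma wbounded_unit : wbounded (fun=> wunit R (A := A)).
Proof.
move=> [|a w]; first by rewrite weight_nil; apply: bounded_cst.
exact: bounded0.
Qed.

Lemma wbounded_wpow y k : wbounded y -> wbounded (fun x => wpow (y x) k).
Proof.
move=> hy; elim: k => [|k IH]; first exact: wbounded_unit.
exact: wbounded_wconv.
Qed.

Lemma wbounded_wlog y : wbounded y -> wbounded (fun x => wlog (y x)).
Proof.
move=> hy w.
apply: (@eq_bounded _ (fun x => \sum_(j < (size w).+1)
    wpow (fun w => y x w - wunit R w) j w * (binpoly R j)`_1)).
  by move=> x _; rewrite wlogE.
apply: bounded_sum => j; apply: boundedMr.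
apply: (wbounded_wpow (y := fun x w => y x w - wunit R w)) => v.
by apply: boundedB; [apply: hy | apply: wbounded_unit].
Qed.

Lemma wbounded_extend n y : wbounded y -> wbounded (fun x => extend wt n (y x)).
Proof.
move=> hy w; rewrite /extend; case: eqP => _ //.
by apply: boundedN; apply: wbounded_wlog.
Qed.

End BoundedFunctionals.

End HomogeneousBounds.

(** * Extension of a truncated geometric rough path by one weight *)

Section Extension.
Import numFieldNormedType.Exports.
Context (R : realType) (gamma : R) (gamma_gt0 : 0 < gamma).
Context (A : choiceType) (wt : A -> nat) (wt_gt0 : forall a, (0 < wt a)%N).
Local Notation weight := (weight wt).
Local Notation I t := (0 <= t <= 1).
Implicit Types (r s t u : R) (w p q : seq A) (Y : R -> R -> seq A -> R).

Definition hoelder k (f : R -> R -> R) :=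
  bounded gamma (fun x : R * R => I x.1 /\ I x.2) (fun x => `|x.2 - x.1|) k
    (fun x => f x.1 x.2).

(** Vanishing above weight [n] is the normalization under which [extend] is the exponential of a
    truncated logarithm. *)
Definition geometric_upto n Y :=
  [/\ forall s t, I s -> I t -> tchar wt n (Y s t),
      forall s t w, I s -> I t -> (n < weight w)%N -> Y s t w = 0,
      forall s u t, I s -> I u -> I t ->
        agree wt n (wconv (Y s u) (Y u t)) (Y s t)
    & forall w, hoelder (weight w) (fun s t => Y s t w)].

(** For nonempty [u] and [v] the product of values only sees weights at most [n], where [h]
    vanishes. Multiplicativity in weight n + 1 is thus affine in the top component. *)
Lemma tchar_perturb n (y h : seq A -> R) : tchar wt n.+1 y ->
  (forall w, (weight w <= n)%N -> h w = 0) ->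
  (forall u v : seq A, u <> [::] -> v <> [::] -> (weight u + weight v)%N = n.+1 ->
    shw h u v = 0) ->
  tchar wt n.+1 (fun w => y w + h w).
Proof.
move=> hy h0 hh.
have one : y [::] + h [::] = 1 by rewrite h0 ?weight_nil // hy.1 addr0.
split=> // u v; rewrite leq_eqVlt ltnS => /orP[/eqP huv|huv]; last first.
  rewrite -[RHS](hy.2 u v) ?(leq_trans huv) // /shdefect.
  rewrite (@eq_shw _ _ _ y); last first.
    by move=> w /weight_perm e; rewrite h0 ?addr0 // e weight_cat.
  by rewrite !h0 ?addr0 // (leq_trans _ huv) ?leq_addl ?leq_addr.
have [->|/eqP hu] := eqVneq u [::]; first by rewrite /shdefect shw_nill one mul1r subrr.
have [->|/eqP hv] := eqVneq v [::]; first by rewrite /shdefect shw_nilr one mulr1 subrr.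
have pu := weight_gt0 wt_gt0 hu; have pv := weight_gt0 wt_gt0 hv.
have wu : (weight u <= n)%N by clear -pv huv; lia.
have wv : (weight v <= n)%N by clear -pu huv; lia.
rewrite /shdefect shwD hh // !h0 // !addr0; apply: hy.2.
by rewrite huv.
Qed.

Lemma wconv_perturb n (y z h k : seq A -> R) w : y [::] = 1 -> z [::] = 1 ->
  (forall w, (weight w <= n)%N -> h w = 0) ->
  (forall w, (weight w <= n)%N -> k w = 0) -> weight w = n.+1 ->
  wconv (fun w => y w + h w) (fun w => z w + k w) w = wconv y z w + h w + k w.
Proof.
move=> y1 z1 h0 k0 hw.
have e1 := @wconv_topl R A wt wt_gt0 n (fun w => y w + h w) y z w _ z1 hw.
have e2 := @wconv_topr R A wt wt_gt0 n (fun w => y w + h w) (fun w => z w + k w) z w _ _ hw.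
rewrite -[LHS](subrK (wconv (fun w => y w + h w) z w)) e2; last first.
- by rewrite h0 ?weight_nil // y1 addr0.
- by move=> v hv; rewrite k0 ?addr0.
rewrite -[X in _ + X](subrK (wconv y z w)) e1; last first.
  by move=> v hv; rewrite h0 ?addr0.
by ring.
Qed.

Lemma geometric_extension n Y : gamma * n.+1%:R < 1 -> geometric_upto n Y ->
  exists2 Y', geometric_upto n.+1 Y' &
    forall s t, I s -> I t -> agree wt n (Y s t) (Y' s t).
Proof.
move=> g1 [Ych Y0 YM Yb].
pose a s t := extend wt n (Y s t).
have a_ch s t : I s -> I t -> tchar wt n.+1 (a s t).
  by move=> hs ht; apply: tchar_extend => // [|w]; [apply: Ych | apply: Y0].
have aY s t : agree wt n (a s t) (Y s t) by apply: agree_extend.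
have a_M s u t : I s -> I u -> I t -> agree wt n (wconv (a s u) (a u t)) (a s t).
  move=> hs hu ht w hw; rewrite (agree_wconv (aY s u) (aY u t)) //.
  by rewrite (YM _ _ _ hs hu ht) // aY.
pose c w s u t := if weight w == n.+1 then wconv (a s u) (a u t) w - a s t w else 0.
(* Both sides are the defect of the triple product of [a r s], [a s u] and [a u t] relative to
   [a r t], bracketed in the two possible ways. *)
have c_cocycle w r s u t : I r -> I s -> I u -> I t ->
    c w r s t + c w s u t = c w r u t + c w r s u.
  move=> hr hs hu ht; rewrite /c; case: eqP => // hw.
  have e1 := wconv_topl wt_gt0 (a_M _ _ _ hr hs hu) (a_ch _ _ hu ht).1 hw.
  have e2 := wconv_topr wt_gt0 (a_M _ _ _ hs hu ht) (a_ch _ _ hr hs).1 hw.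
  by rewrite wconvA in e1; lra.
have a_b w : hoelder (weight w) (fun s t => a s t w).
  exact: (wbounded_extend gamma_gt0).
have c_b w : exists2 C, 0 <= C & forall s u t, I s -> I u -> I t ->
    `|c w s u t| <= C * (`|u - s| + `|t - u|) `^ (gamma * n.+1%:R).
  rewrite /c; case: eqP => hw; last first.
    by exists 0 => // s u t *; rewrite normr0 mul0r.
  pose T3 := (R * R * R)%type.
  pose D3 (x : T3) := [/\ I x.1.1, I x.1.2 & I x.2].
  pose m3 (x : T3) := `|x.1.2 - x.1.1| + `|x.2 - x.1.2|.
  have lift (f : R -> R -> R) k (p q : T3 -> R) : hoelder k f ->
      (forall x, D3 x -> I (p x) /\ I (q x)) ->
      (forall x, `|q x - p x| <= m3 x) -> bounded gamma D3 m3 k (fun x => f (p x) (q x)).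
    move=> [C C0 h] hI hm; exists C => // x Dx; have [h1 h2] := hI _ Dx.
    apply: le_trans (h (p x, q x) (conj h1 h2)) _.
    rewrite ler_wpM2l // ge0_ler_powR ?nnegrE ?addr_ge0 // ?hm //.
    by rewrite mulr_ge0 ?ler0n // ltW.
  have [] : bounded gamma D3 m3 (weight w)
      (fun x => wconv (a x.1.1 x.1.2) (a x.1.2 x.2) w - a x.1.1 x.2 w).
    apply: boundedB.
      apply: (wbounded_wconv gamma_gt0 (y := fun x => a x.1.1 x.1.2)
        (z := fun x => a x.1.2 x.2)) => v; apply: (lift _ _ _ _ (a_b v)).
      - by move=> x [].
      - by move=> x; rewrite lerDl.
      - by move=> x [].
      - by move=> x; rewrite lerDr.
    apply: (lift _ _ _ _ (a_b w)) => x; first by case.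
    by rewrite -(subrKA x.1.2) addrC; apply: ler_normD.
  by move=> C C0 h; exists C => // s u t hs hu ht; rewrite -hw; apply: (h (s, u, t)).
have th0 : 0 < gamma * n.+1%:R by rewrite mulr_gt0 ?ltr0n.
have c_cv w t : I t -> cvgn (dyapprox (c w) t).
  by have [C _ hC] := c_b w; apply: (dyapprox_cvg th0 g1 (c_cocycle w) hC).
pose h s t w := if weight w == n.+1 then primitive (c w) s t else 0.
have h0 s t w : (weight w <= n)%N -> h s t w = 0.
  by rewrite /h; case: eqP => // -> ; rewrite ltnn.
have h_sh s t (u v : seq A) : I s -> I t -> u <> [::] -> v <> [::] ->
    (weight u + weight v)%N = n.+1 -> shw (h s t) u v = 0.
  move=> hs ht hu hv huv.
  have wuv w : perm_eq w (u ++ v) -> weight w = n.+1.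
    by move=> /weight_perm ->; rewrite weight_cat.
  rewrite (@eq_shw _ _ _ (fun w => primitive (c w) s t)); last first.
    by move=> w /wuv e; rewrite /h e eqxx.
  apply: (primitive_ev_eq0 (x := shuffle_seq R u v) (c := fun w : {fmonom A} => c w)
    (fun w : {fmonom A} => @c_cv w) _ hs ht) => r s' t' hr hs' ht'.
  (* Two characters that agree up to weight [n] are subtracted: on the shuffle of [u] and [v] both
     equal products of values in smaller weights, which cancel. *)
  transitivity (shw (fun w => wconv (a r s') (a s' t') w - a r t' w) u v).
    by apply: (eq_shw (phi := fun w => c w r s' t')) => w /wuv e; rewrite /c e eqxx.
  have wu : (weight u <= n)%N.
    by have := weight_gt0 wt_gt0 hv; clear -huv; lia.
  have wv : (weight v <= n)%N.
    by have := weight_gt0 wt_gt0 hu; clear -huv; lia.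
  have ch1 := tchar_wconv (a_ch _ _ hr hs') (a_ch _ _ hs' ht').
  rewrite shwB (tcharM ch1) ?huv // (tcharM (a_ch _ _ hr ht')) ?huv //.
  by rewrite !(a_M _ _ _ hr hs' ht') // subrr.
exists (fun s t w => a s t w + h s t w); last first.
  by move=> s t hs ht w hw; rewrite h0 // addr0 aY.
split.
- move=> s t hs ht; apply: tchar_perturb; first exact: a_ch.
    by move=> w; apply: h0.
  by move=> u v; apply: h_sh.
- move=> s t w hs ht hw; rewrite /h /a /extend gt_eqF // Y0 ?addr0 //.
  exact: ltnW.
- move=> s u t hs hu ht w; rewrite leq_eqVlt ltnS => /orP[/eqP hw|hw].
    rewrite (wconv_perturb (a_ch _ _ hs hu).1 (a_ch _ _ hu ht).1 (h0 s u) (h0 u t) hw).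
    rewrite /h hw eqxx; have [C _ hC] := c_b w.
    rewrite (primitive_cocycle (c_cocycle w) hs hu ht).
    by rewrite [c w s u t]/c hw eqxx; ring.
  rewrite (@agree_wconv _ _ wt n _ (a s u) _ (a u t)) //.
  + by rewrite a_M // h0 ?addr0.
  + by move=> v hv; rewrite h0 ?addr0.
  + by move=> v hv; rewrite h0 ?addr0.
- move=> w; apply: boundedD; first exact: a_b.
  rewrite /h; case: eqP => hw; last exact: bounded0.
  have [C _ hC] := c_b w.
  have [C' [C'0 h']] := primitive_le th0 g1 (c_cocycle w) hC.
  by exists C' => // -[s t] [/= hs ht]; rewrite hw; apply: h'.
Qed.

End Extension.

(** * Matching the branched rough path through psi *)

Section BranchedLift.
Context (R : realType) (d : nat).
Implicit Types (a : tree d) (f g : forest d) (s t u : R).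
Local Notation word := (seq (tree d)).
Local Notation weight := (weight (@tnodes d)).
Local Notation I t := (0 <= t <= 1).
Local Notation tpos := (@tnodes_gt0 d).

Lemma hkevM_tchar n (y : word -> R) f g : tchar (@tnodes d) n y ->
  (fnodes (mmul f g) <= n)%N -> hkev (mmul f g) y = hkev f y * hkev g y.
Proof.
move=> hy hn; rewrite hkevM.
transitivity (hkev f (fun p => y p * hkev g y)); last exact: ev_mulrr.
apply: eq_hkev_graded => u hu.
transitivity (hkev g (fun v => y u * y v)); last exact: ev_mulrl.
apply: eq_hkev_graded => v hv.
by apply: (tcharM hy); rewrite hu hv -fnodesM.
Qed.

(** Dual form of the coalgebra morphism: composition with psi carries Chen's relation on words to
    Chen's relation on forests. *)
Lemma hkev_wconv f (y z : word -> R) :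
  hkev f (wconv y z) = cev f (fun p => hkev p.1 y * hkev p.2 z).
Proof.
rewrite /wconv hkev_deconc; apply: eq_cev => p.
by rewrite /hkev -ev_mulrr; apply: eq_ev => u; rewrite ev_mulrl.
Qed.

Section RoughPath.
Context (gamma : R) (gamma_gt0 : 0 < gamma).
Context (X : R -> R -> {scalar (BCK R d)}) (hX : branched_rough_path gamma X).

Lemma rough_path_char s t : I s -> I t -> is_character (X s t).
Proof. by case: hX => h _ _ hs ht; apply: h; rewrite in_itv. Qed.

Lemma rough_path1 s t : I s -> I t -> X s t << mone >> = 1.
Proof.
move=> hs ht; have [[x x0] XM] := rough_path_char hs ht.
by apply: (mulfI x0); rewrite -XM -[<< mone >>]/(1 : BCK R d) !mulr1.
Qed.

Lemma rough_pathM s t f g : I s -> I t ->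
  X s t << mmul f g >> = X s t << f >> * X s t << g >>.
Proof.
move=> hs ht; have [_ XM] := rough_path_char hs ht; rewrite -XM; congr (X s t _).
by rewrite [RHS]malgM_def fgmulUU mulr1.
Qed.

Lemma rough_path_chen s u t f : I s -> I u -> I t ->
  X s t << f >> = cev f (fun p => X s u << p.1 >> * X u t << p.2 >>).
Proof.
case: hX => _ h _ hs hu ht; rewrite -(h s u t) ?in_itv //.
by rewrite /conv coprodU.
Qed.

Definition compatible n (Y : R -> R -> word -> R) :=
  forall s t f, I s -> I t -> (fnodes f <= n)%N -> X s t << f >> = hkev f (Y s t).

Lemma branched_lift0 : exists2 Y : R -> R -> word -> R,
  geometric_upto gamma (@tnodes d) 0 Y & compatible 0 Y.
Proof.
exists (fun _ _ => wunit R (A := tree d)).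
  split=> [s t _ _|s t [|a w] _ _|s u t _ _ _|w].
  - exact: tchar_unit.
  - by rewrite weight_nil.
  - by [].
  - by rewrite wconv1l.
  - exact: (wbounded_unit gamma).
move=> s t f hs ht; rewrite leqn0 => /eqP /fnodes_eq0 ->.
by rewrite hkev1 rough_path1.
Qed.

Lemma branched_liftS n (Y : R -> R -> word -> R) : gamma * n.+1%:R < 1 ->
  geometric_upto gamma (@tnodes d) n Y -> compatible n Y ->
  exists2 Y' : R -> R -> word -> R,
    geometric_upto gamma (@tnodes d) n.+1 Y' & compatible n.+1 Y'.
Proof.
move=> g1 Yg Yc; have [Z [Zch Z0 ZM Zb] ZY] := geometric_extension gamma_gt0 tpos g1 Yg.
have Zc s t f : I s -> I t -> (fnodes f <= n)%N -> X s t << f >> = hkev f (Z s t).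
  move=> hs ht hf; rewrite (Yc _ _ _ hs ht hf); apply: eq_hkev_graded => w hw.
  by rewrite (ZY _ _ hs ht) // hw.
pose delta s t f := X s t << f >> - hkev f (Z s t).
have delta0 s t f : I s -> I t -> (fnodes f <= n)%N -> delta s t f = 0.
  by move=> hs ht hf; rewrite /delta Zc // subrr.
(* In the coproduct of [f], terms with two nonempty factors have both factors of at most [n] nodes,
   where [X] and [Z] agree through psi. The two extreme terms give the discrepancies over the
   subintervals. *)
have deltaD s u t f : I s -> I u -> I t -> fnodes f = n.+1 ->
    delta s t f = delta s u f + delta u t f.
  move=> hs hu ht hf; rewrite {1}/delta (rough_path_chen f hs hu ht).
  have -> : hkev f (Z s t) = hkev f (wconv (Z s u) (Z u t)).
    by apply: eq_hkev_graded => w hw; rewrite (ZM _ _ _ hs hu ht) // hw hf.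
  rewrite hkev_wconv -[LHS]ev_subr.
  rewrite -[delta s u f](cev_counitr f (delta s u)) -[delta u t f](cev_counitl f (delta u t)).
  rewrite -[RHS]ev_addr; apply: eq_cev_graded => p q; rewrite hf /= => e.
  have [->|np] := eqVneq p mone.
    rewrite (delta0 _ _ mone) ?fnodes1 // rough_path1 // hkev1 (Zch _ _ hs hu).1.
    by rewrite [_ * (q == _)%:R]mul0r add0r [X in X - _]mul1r [X in _ - X]mul1r [RHS]mul1r.
  have [->|nq] := eqVneq q mone.
    rewrite (rough_path1 hu ht) hkev1 (Zch _ _ hu ht).1 [X in X - _]mulr1 [X in _ - X]mulr1.
    by rewrite mul0r addr0 mulr1.
  have hp : (0 < fnodes p)%N by rewrite lt0n; apply: contra np => /eqP /fnodes_eq0 ->.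
  have hq : (0 < fnodes q)%N by rewrite lt0n; apply: contra nq => /eqP /fnodes_eq0 ->.
  have pn : (fnodes p <= n)%N by clear -e hq; lia.
  have qn : (fnodes q <= n)%N by clear -e hp; lia.
  by rewrite (Zc _ _ p) // (Zc _ _ q) // subrr [X in X + _]mulr0 [X in _ + X]mul0r addr0.
pose k s t a := if tnodes a == n.+1 then delta s t (ucm a) else 0.
(* Being carried by single letters, it vanishes on shuffles of nonempty words, and psi(a) meets it
   only through the letter [a]. *)
pose kappa s t (w : word) := if w is [:: a] then k s t a else 0.
have kappa0 s t w : weight w <> n.+1 -> kappa s t w = 0.
  case: w => [|a [|b w]] //=; rewrite weight_cons weight_nil addn0 /k.
  by case: eqP.
have kappa0' s t w : (weight w <= n)%N -> kappa s t w = 0.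
  by move=> hw; apply: kappa0 => e; rewrite e ltnn in hw.
pose Y' s t w := Z s t w + kappa s t w.
have Y'ch s t : I s -> I t -> tchar (@tnodes d) n.+1 (Y' s t).
  move=> hs ht; apply: (tchar_perturb tpos (Zch _ _ hs ht) (kappa0' s t)).
  move=> p q hp hq _; rewrite (@eq_shw _ _ _ (fun=> 0)); first by rewrite /shw ev_eq0.
  move=> w /perm_size; rewrite size_cat; case: p hp => // b p _; case: q hq => // b' q _.
  by case: w => [|? [|? ?]] //=; rewrite addnS.
exists Y'.
  split => //.
  - move=> s t w hs ht hw; rewrite /Y' Z0 // kappa0 ?addr0 // => e.
    by rewrite e ltnn in hw.
  - move=> s u t hs hu ht w; rewrite leq_eqVlt ltnS => /orP[/eqP hw|hw].
      rewrite (wconv_perturb tpos (Zch _ _ hs hu).1 (Zch _ _ hu ht).1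
        (kappa0' s u) (kappa0' u t) hw).
      rewrite (ZM _ _ _ hs hu ht) ?hw // -addrA; congr (_ + _).
      case: w hw => [|a [|b w]] /=; rewrite ?addr0 // weight_cons weight_nil addn0 => hw.
      by rewrite /k hw eqxx -deltaD ?fnodesU.
    rewrite (@agree_wconv _ _ (@tnodes d) n _ (Z s u) _ (Z u t)) //.
    + by rewrite (ZM _ _ _ hs hu ht w (leqW hw)) /Y' kappa0' ?addr0.
    + by move=> v hv; rewrite /Y' kappa0' ?addr0.
    + by move=> v hv; rewrite /Y' kappa0' ?addr0.
  - move=> w; apply: boundedD; first exact: Zb.
    rewrite /kappa; case: w => [|a [|b w]]; try exact: bounded0.
    rewrite weight_cons weight_nil addn0 /k; case: eqP => [hw|_]; last exact: bounded0.
    apply: boundedB.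
      case: hX => _ _ /(_ (ucm a)) [C hC]; exists `|C| => // -[s t] [/= hs ht].
      rewrite (le_trans (hC s t _ _)) ?in_itv // fnodesU.
      by rewrite ler_wpM2r ?powR_ge0 ?ler_norm.
    (* All words of psi(a) have weight [tnodes a]; testing the weight gives every summand the same
       exponent. *)
    apply: (@eq_bounded _ _ _ _ _ _ (fun x => \sum_(w <- msupp (hk_forest R (ucm a)))
      (if weight w == tnodes a then Z x.1 x.2 w else 0) * (hk_forest R (ucm a))@_w)).
      move=> -[s t] _ /=.
      transitivity (hkev (ucm a) (fun w => if weight w == tnodes a then Z s t w else 0)).
        by rewrite /hkev evE; apply: eq_bigr => w _; rewrite mulrC.
      by apply: eq_hkev_graded => w; rewrite fnodesU => ->; rewrite eqxx.
    apply: bounded_sum => w; apply: (boundedMr gamma_gt0).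
    by case: eqP => [<-|_]; [apply: Zb | apply: bounded0].
(* Only trees need the correction, since both sides are multiplicative on products. *)
move=> s t f hs ht; elim/forest_ind: f => [|f g IHf IHg|i f IH] hf.
- by rewrite rough_path1 // hkev1 (Y'ch _ _ hs ht).1.
- rewrite rough_pathM // (hkevM_tchar (Y'ch _ _ hs ht)) //.
  rewrite fnodesM in hf; congr (_ * _).
    by apply: IHf; rewrite (leq_trans _ hf) ?leq_addr.
  by apply: IHg; rewrite (leq_trans _ hf) ?leq_addl.
have -> : hkev (ucm (graft i f)) (Y' s t) =
    hkev (ucm (graft i f)) (Z s t) + k s t (graft i f).
  by rewrite -[k s t _](hkev_letter _ (k s t)) -[RHS]ev_addr.
rewrite /k; case: eqP => [_|ne]; first by rewrite /delta addrC subrK.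
rewrite addr0 Zc //; move: hf; rewrite leq_eqVlt ltnS => /orP[/eqP|//].
by rewrite fnodesU.
Qed.

End RoughPath.
End BranchedLift.

(** * From functions on words to linear forms on the truncated space *)

Section WordFunctionals.
Context (R : realType) (d N : nat).
Local Notation word := (seq (tree d)).
Local Notation weight := (weight (@tnodes d)).
Local Notation Ha := {malg R[aword d N]}.
Implicit Types (y z : word -> R) (x : Ha).

Definition Ha_ev y x : R := ev x (fun w => y (aval w)).

Lemma Ha_ev_scalar y : scalar (Ha_ev y).
Proof. by move=> a x x'; rewrite /Ha_ev evD evZ. Qed.

HB.instance Definition _ y :=
  GRing.isLinear.Build R Ha R *%R (Ha_ev y) (Ha_ev_scalar y).

Lemma Ha_evU y (w : aword d N) : Ha_ev y << w >> = y (aval w).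
Proof. exact: evU. Qed.

Lemma Ha_ev_incl y x : Ha_ev y x = ev (Ha_incl x) (fun w : {fmonom tree d} => y w).
Proof. by rewrite /Ha_incl ev_linext; apply: eq_ev => w; rewrite evU. Qed.

Lemma weight_aval (w : aword d N) : (weight (aval w) <= N)%N.
Proof. by case: w => w /= /andP[]. Qed.

Lemma in_aword_weight (w : word) : (weight w <= N)%N -> in_aword N w.
Proof.
move=> h; rewrite /in_aword h andbT; apply/allP => a aw.
by apply: leq_trans h; rewrite /weight (big_rem a) //= leq_addr.
Qed.

Lemma Ha_ev_agree y z x : agree (@tnodes d) N y z -> Ha_ev y x = Ha_ev z x.
Proof. by move=> h; apply: eq_ev => w; rewrite h ?weight_aval. Qed.

Lemma Ha_counitE x : Ha_counit x = Ha_ev (wunit R (A := tree d)) x.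
Proof.
rewrite Ha_ev_incl /Ha_counit /counit evE [X in mcoeff _ X]monalgE raddf_sum.
apply: eq_bigr => w _; rewrite [LHS]mcoeffU mulr_natr; congr (_ *+ nat_of_bool _).
by rewrite fmP fm1.
Qed.

Lemma conv_Ha_ev y z x :
  conv (@deconcat R d N) (Ha_ev y) (Ha_ev z) x = Ha_ev (wconv y z) x.
Proof.
rewrite /conv /deconcat -[LHS]/(ev _ _) ev_linext; apply: eq_ev => w.
rewrite ev_sum /wconv deconc_take; apply: eq_bigr => i _.
by rewrite evU !Ha_evU.
Qed.

Lemma conv_exp_Ha_ev k y x : conv_exp k (Ha_ev y) x = Ha_ev (wpow y k) x.
Proof.
suff -> : conv_exp k (Ha_ev y) = Ha_ev (wpow y k) by [].
elim: k => [|k IH]; first by apply/funext => z; apply: Ha_counitE.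
by rewrite /conv_exp iterS -/(conv_exp k _) IH; apply/funext => z; apply: conv_Ha_ev.
Qed.

Lemma in_Ga_Ha_ev y : tchar (@tnodes d) N y -> in_Ga (Ha_ev y).
Proof.
move=> hy; exists (Ha_ev (wlog y)) => [x1 x2 x3 e|x]; last first.
  transitivity (Ha_ev (fun w => \sum_(k < N.+1) (k`!%:R)^-1 * wpow (wlog y) k w) x).
    apply: Ha_ev_agree => w hw; apply: wexp_wlog; first exact: hy.1.
    by apply: leq_trans hw; apply: size_weight; apply: tnodes_gt0.
  rewrite /Ha_ev ev_sumr; apply: eq_bigr => k _.
  by rewrite conv_exp_Ha_ev -ev_mulrl.
(* The shuffle of two elements may lie in the truncated space although single words shuffle to
   weights above [N]. Cutting the logarithm off there makes the Leibniz rule hold for every pair of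
   words. *)
pose L w := if (weight w <= N)%N then wlog y w else 0.
have HL x : Ha_ev (wlog y) x = Ha_ev L x.
  by apply: Ha_ev_agree => w hw; rewrite /L hw.
have Lnil : L [::] = 0 by rewrite /L weight_nil wlog_nil ?hy.1.
have L_sh u v : shw L u v = L u * wunit R v + wunit R u * L v.
  have [->|/eqP hu] := eqVneq u [::]; first by rewrite shw_nill Lnil mul0r add0r mul1r.
  have [->|/eqP hv] := eqVneq v [::]; first by rewrite shw_nilr Lnil mulr0 addr0 mulr1.
  have -> : wunit R u = 0 by case: u hu.
  have -> : wunit R v = 0 by case: v hv.
  rewrite mulr0 mul0r addr0.
  have [huv|huv] := leqP (weight u + weight v) N.
    rewrite (@eq_shw_agree _ _ (@tnodes d) N _ (wlog y)) //; last by move=> w hw; rewrite /L hw.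
    rewrite (shw_wlog (@tnodes_gt0 d) hy) // ?hy.2 //.
    exact: leq_trans huv _.
  rewrite (@eq_shw _ _ _ (fun=> 0)); first by rewrite /shw ev_eq0.
  by move=> w /weight_perm pw; rewrite /L pw weight_cat leqNgt huv.
rewrite -[LHS]/(Ha_ev (wlog y) x3) -[RHS]/(Ha_ev (wlog y) x1 * _ + _ * Ha_ev (wlog y) x2).
rewrite !HL !Ha_counitE Ha_ev_incl -e shuffle_def ev_linext !Ha_ev_incl.
rewrite -!ev_mulrr -ev_addr; apply: eq_ev => u.
rewrite ev_linext -!ev_mulrl -ev_addr.
by apply: eq_ev => v; apply: L_sh.
Qed.

Lemma Ha_incl_hairer_kelly f : (fnodes f <= N)%N ->
  exists z : Ha, Ha_incl z = hairer_kelly << f >>.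
Proof.
move=> hf; rewrite hairer_kellyU.
(* The default 0 is never reached: words of psi(f) have weight [fnodes f]. *)
exists (linext (fun w : {fmonom tree d} =>
  if insub (w : word) is Some v then << (v : aword d N) >> else 0) (hk_forest R f)).
rewrite linextE /Ha_incl linear_sum [RHS]monalgE big_seq [RHS]big_seq.
apply: eq_bigr => -[w]; rewrite -mcoeff_neq0 => hw.
have aw : in_aword N w by apply: in_aword_weight; rewrite (hk_forest_supp hw).
by rewrite linearZ /= insubT linextU1 [RHS]malgUZ.
Qed.

End WordFunctionals.

Theorem theorem1p6 (R : realType) (d : nat) (hd : (1 <= d)%N)
    (gamma : R) (hgamma : 0 < gamma < 1) (hgammaN : gamma^-1 \isn't a Num.nat)
    (N : nat) (hN : N%:Z = Num.floor gamma^-1)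
    (X : R -> R -> {scalar (BCK R d)}) (hX : branched_rough_path gamma X) :
  exists Xbar : R -> R -> {scalar {malg R[aword d N]}},
    anisotropic_rough_path gamma Xbar /\
    {in `[0, 1] &, forall s t, forall f : forest d, (fnodes f <= N)%N ->
      exists2 z, Ha_incl z = hairer_kelly << f >> & X s t << f >> = Xbar s t z}.
Proof.
case/andP: hgamma => g0 g1.
have gN n : (n <= N)%N -> gamma * n%:R < 1.
  move=> hn; rewrite mulrC -ltr_pdivlMr // div1r.
  have gi0 : 0 <= gamma^-1 by rewrite invr_ge0 ltW.
  have NE : N = Num.truncn gamma^-1.
    by rewrite truncn_floor gi0 -hN.
  (* Equality is excluded because gamma^-1 is not a natural number. *)
  rewrite lt_neqAle; apply/andP; split.
    by apply: contra hgammaN => /eqP <-; apply: natr_nat.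
  by rewrite -truncn_ge_nat // -NE.
have [Y Yg Yc] : exists2 Y : R -> R -> seq (tree d) -> R,
    geometric_upto gamma (@tnodes d) N Y & compatible X N Y.
  move: {hN}N gN => M; elim: M => [|n IH] gN; first exact: branched_lift0 hX.
  have [|Y Yg Yc] := IH; first by move=> k /leqW; apply: gN.
  exact: (branched_liftS g0 hX (gN _ (leqnn _)) Yg Yc).
have [Ych _ YM Yb] := Yg.
exists (fun s t => Ha_ev (Y s t)); split; last first.
  move=> s t; rewrite !in_itv /= => hs ht f hf.
  have [z hz] := Ha_incl_hairer_kelly R hf; exists z => //.
  rewrite -[RHS]/(Ha_ev (Y s t) z) (Yc _ _ _ hs ht hf) Ha_ev_incl hz.
  by rewrite hairer_kellyU.
split.
- by move=> s t; rewrite !in_itv /= => hs ht; apply/in_Ga_Ha_ev/Ych.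
- move=> s u t; rewrite !in_itv /= => hs hu ht x.
  by rewrite [LHS]conv_Ha_ev; apply: Ha_ev_agree; apply: YM.
move=> w; have [C _ hC] := Yb (aval w); exists C => s t.
rewrite !in_itv /= => hs ht; rewrite -[X in `|X|]/(Ha_ev (Y s t) _) Ha_evU.
exact: (hC (s, t) (conj hs ht)).
Qed.
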